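(* Let $d$ be a prime. Let $c_0\in\mathbb{C}$ be a root of $G_{d,n}$ for some $n \geq 1$. Set $K = \mathbb{Q}(c_0)$. (a) If $\alpha \in K$ satisfies $v_{\mathfrak{p}}(\alpha) = 1$ for some prime $\mathfrak{p} \subset \mathcal{O}_K$ above $d$, then the pair $(f_{d,c_0}, \alpha)$ is stable over $K$. (b) Suppose further that $n\geq 2$. For any $k \geq 1$, write $k = nq + r$ for some integers $q \geq 0$ and $0 \leq r < n$. Then $f_{d,c_0}^k$ factors as $$f_{d,c_0}^k = \left(\prod_{j=0}^{q-1} \prod_{i=1}^{n-1} \left(F_{k - nj - i,\, n - i}^{(d,c_0)}\right)^{d^j}\right) \left((x - a_{n - r}(c_0)) \prod_{i=1}^r F_{r - i,\, n - i}^{(d,c_0)}\right)^{d^q}$$ over $K$ (an empty product is $1$). Moreover, the polynomials $F_{k-nj-i,\,n-i}^{(d,c_0)}$ (for $0\le j\le q-1$, $1\le i\le n-1$) and $F_{r-i,\,n-i}^{(d,c_0)}$ (for $1\le i\le r$) are distinct and irreducible over $K$.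
   Context: For a prime $d$ and $c_0\in\mathbb{C}$, $f_{d,c_0}=x^d+c_0$. For a polynomial $f$, $f^n$ denotes the $n$-th iterate: $f^0=x$, $f^n=f\circ f^{n-1}$ for $n\ge 1$. Define polynomials $a_i=a_i(c)\in\mathbb{Z}[c]$ (depending on $d$) by $a_1=c$ and $a_{i+1}=a_i^d+c$ for $i\ge 1$; thus $a_i(c_0)=f_{d,c_0}^i(0)$. For $n\ge 1$, $G_{d,n}=G_{d,0,n}\in\mathbb{Z}[c]$ is the monic polynomial $$G_{d,n}(c):=\prod_{k\mid n}(a_k)^{\mu(n/k)},$$ where $\mu$ is the Möbius function. (Its roots are the Gleason parameters of period $n$, i.e. those $c_0$ with $f_{d,c_0}^n(0)=0$ and $f_{d,c_0}^i(0)\ne 0$ for $0<i<n$.) For $n\ge 2$, a root $c_0$ of $G_{d,n}$, a $d$-th root of unity $\zeta\ne 1$, $k\ge 0$ and $1\le i\le n-1$, define $$F_{k,i}^{(d,c_0)} = \prod_{j=1}^{d-1} \left(f_{d,c_0}^k - \zeta^j a_i(c_0)\right)$$ (this does not depend on the choice of $\zeta$). $\mathcal{O}_K$ is the ring of integers of $K$, and $v_{\mathfrak{p}}$ is the normalized $\mathfrak{p}$-adic valuation on $K$. For a field $K$, $\alpha\in K$ and $f\in K[x]$ of degree at least $2$, the pair $(f,\alpha)$ is stable over $K$ if $f^n-\alpha$ is irreducible over $K$ for all $n\ge 1$. *)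

(* Defs.v *)
(* MathComp, with classical logic (mathcomp.classical) and the complex numbers
   R[i] over a realType R. *)
From HB Require Import structures.
From mathcomp Require Import all_boot all_order all_algebra all_field.
From mathcomp Require Import ring_quotient.
From mathcomp Require Import boolp reals.
From mathcomp Require Import complex.

Set Implicit Arguments.
Unset Strict Implicit.
Unset Printing Implicit Defensive.

Import Order.TTheory GRing.Theory Num.Theory.
Local Open Scope ring_scope.

(* The n-th iterate f o ... o f of a polynomial; f \Po g is f(g(x)). *)
Definition iterp (R : nzRingType) (f : {poly R}) (n : nat) : {poly R} :=
  iter n (fun g => f \Po g) 'X.

Definition unicrit (R : nzRingType) (d : nat) (c : R) : {poly R} :=
  'X^d + c%:P.

Definition stable (K : fieldType) (f : {poly K}) (alpha : K) : Prop :=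
  forall n : nat, (0 < n)%N -> irreducible_poly (iterp f n - alpha%:P).

(* a_1 = c, a_{i+1} = a_i^d + c; only i >= 1 is meaningful (a_poly d 0 is a
   dummy value equal to a_1). *)
Definition a_poly (d i : nat) : {poly int} :=
  iter i.-1 (fun p => p ^+ d + 'X) 'X.

Definition a_val (R : nzRingType) (d : nat) (c : R) (i : nat) : R :=
  (map_poly (intr : int -> R) (a_poly d i)).[c].

(* Only n >= 1 is meaningful. *)
Definition moebius (n : nat) : int :=
  if all (fun p => logn p n == 1%N) (primes n) then (-1) ^+ size (primes n)
  else 0.

(* G is the Gleason polynomial G_{d,n}: the defining product is taken in the
   field of fractions of Z[c], into which Z[c] embeds by %:F, so that it
   determines G uniquely. *)
Definition is_gleason (d n : nat) (G : {poly int}) : Prop :=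
  tofrac G = \prod_(k <- divisors n) tofrac (a_poly d k) ^ moebius (n %/ k)%N.

Definition F_fac (R : nzRingType) (d : nat) (zeta c0 : R) (k i : nat)
    : {poly R} :=
  \prod_(1 <= j < d)
    (iterp (unicrit d c0) k - (zeta ^+ j * a_val d c0 i)%:P).

Section RingOfIntegers.
Variable K : fieldType.

Definition int_closure : {pred K} :=
  fun x => `[< integralOver (intr : int -> K) x >].

Fact int_closure_subring : subring_closed int_closure.
Proof.
split; first by apply/asboolP/integral1.
- by move=> x y /asboolP Ix /asboolP Iy; apply/asboolP/integral_sub.
- by move=> x y /asboolP Ix /asboolP Iy; apply/asboolP/integral_mul.
Qed.

HB.instance Definition _ :=
  GRing.isSubringClosed.Build K int_closure int_closure_subring.

Record ringOfIntegers :=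
  RingOfIntegers { OK_val :> K; _ : OK_val \in int_closure }.

HB.instance Definition _ := [isSub for OK_val].
HB.instance Definition _ := [Choice of ringOfIntegers by <:].
HB.instance Definition _ :=
  [SubChoice_isSubComNzRing of ringOfIntegers by <:].

End RingOfIntegers.

(* Membership in the m-th power of the ideal I: finite sums of products u * v
   with u in I and v in the (m-1)-st power; the 0-th power is the whole ring. *)
Fixpoint in_ideal_pow (R : comNzRingType) (I : {pred R}) (m : nat) (x : R)
    : Prop :=
  if m is m'.+1 then
    exists s : seq (R * R),
      (forall w, w \in s -> (w.1 \in I) /\ in_ideal_pow I m' w.2) /\
      x = \sum_(w <- s) w.1 * w.2
  else True.

(* v_P(x) = m for x in the ring of integers: the exact power of P that
   contains x (no m qualifies for x = 0, whose valuation is infinite). *)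
Definition has_ord (R : comNzRingType) (P : {pred R}) (x : R) (m : nat)
    : Prop :=
  in_ideal_pow P m x /\ ~ in_ideal_pow P m.+1 x.

(* v_P(alpha) = e, extended to K by v_P(x / y) = v_P(x) - v_P(y). *)
Definition has_valuation (K : fieldType) (P : {pred ringOfIntegers K})
    (alpha : K) (e : int) : Prop :=
  exists (x y : ringOfIntegers K) (m n : nat),
    [/\ y != 0, alpha = val x / val y, has_ord P x m, has_ord P y n
      & e = m%:Z - n%:Z].

(* Main.v *)
Require Import Defs.
From HB Require Import structures.
From mathcomp Require Import all_boot all_order all_algebra all_field.
From mathcomp Require Import ring_quotient.
From mathcomp Require Import boolp classical_sets reals.
From mathcomp Require Import complex.
From mathcomp Require Import zify ring.

Set Implicit Arguments.
Unset Strict Implicit.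
Unset Printing Implicit Defensive.

Import Order.TTheory GRing.Theory Num.Theory.
Local Open Scope ring_scope.
Local Open Scope complex_scope.

(** Write [a_k] for the critical orbit of [f = x^d + c] and [M = d ^ n].  The
    whole argument rests on one congruence.  Modulo [d] the relation
    [a_n(c) = 0] is additive in [c], and comparing it with its image under
    Frobenius gives [c ^ M = c] modulo [d * Z[c]]; hence [b ^ M = b] modulo [d]
    for every [b] in [Z[c]] ([frobenius_mod]).  Let [p] be a prime of [Z[c]]
    containing [d].  For [b] in [p] the factor [b ^ (M - 1) - 1] is prime to
    [p] and [b * (b ^ (M - 1) - 1)] is a multiple of [d], so the localization
    at [p] has its maximal ideal generated by [d].  As [K = Q(c)], every
    nonzero [b] divides a positive integer, which bounds how often [d] divides
    it, and the localization is a valuation ring ([local_ring_val],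
    [local_ring_max]).  Thus [d] is a uniformizer at every prime above it.

    All the irreducibility statements are Eisenstein's criterion for this
    valuation ring ([eisenstein_valuation]).  It applies because [f^k] is
    congruent to ['X^(d ^ k) + a_k] modulo [d]; and a factor can be
    replaced by its composition with an iterate of [f], since
    irreducibility of [p \Po g] implies that of [p] ([irreducible_comp]).

    - For (a), [f^m - alpha] composes to [f^(n * m) - alpha], which is
      congruent to ['X^(d ^ (n * m)) - alpha] since [a_(n * m) = 0].  The
      valuation ring contains the integers of [K], the powers of the given prime
      [P] are cut out by the powers of [d], and valuation one means that
      [alpha] is [d] times a unit ([valuation1_local]).

    - For (b), [F_(k,i)] is the quotient of [f^(k+1) - a_(i+1)] by
      [f^k - a_i].  Composing until [k] is congruent to [i] modulo [n] makes it
      monic, a power of ['X] modulo [d], with constant term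
      [d * a_i ^ (d - 1)]; and [a_i] is a unit at [p] for [0 < i < n]
      ([crit_orbit_notin_prime]).  The factorization is a telescoping product
      of these quotients, which restarts with exponent multiplied by [d] each
      time the index of the orbit reaches [1]; the factors are told apart by
      their degrees.

    That [c] has exact period [n] is extracted from the Moebius product
    ([gleason_root_period]).  There, and for the units above, the simplicity of
    the roots of [a_n] is replaced by the identity
    [a_(e * i) = a_i * (1 + a_i ^ (d - 1) * s)] ([crit_orbitM]). *)

(** * Divisibility along the critical orbit *)

(** Starting at [0] rather than at [c] makes [0] the zeroth term, so that
    periodicity includes the index [0]; for [a_poly] that index is a dummy. *)
Definition crit_orbit (R : nzRingType) (d : nat) (c : R) (k : nat) : R :=
  iter k (fun x => x ^+ d + c) 0.

Lemma crit_orbit_rmorph (R S : nzRingType) (f : {rmorphism R -> S}) d c k :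
  f (crit_orbit d c k) = crit_orbit d (f c) k.
Proof.
by elim: k => [|k IHk] /=; rewrite ?rmorph0 // rmorphD rmorphXn /= IHk.
Qed.

Lemma a_polyE d k : (0 < d)%N -> (0 < k)%N -> a_poly d k = crit_orbit d 'X k.
Proof.
case: k => // k d_gt0 _; rewrite /a_poly /crit_orbit.
elim: k => [|k IHk] /=; first by rewrite expr0n eqn0Ngt d_gt0 add0r.
by rewrite IHk.
Qed.

Lemma a_valE (R : comNzRingType) d (c : R) k :
  (0 < d)%N -> (0 < k)%N -> a_val d c k = crit_orbit d c k.
Proof.
move=> d_gt0 k_gt0; rewrite /a_val a_polyE // crit_orbit_rmorph /= map_polyX.
have := crit_orbit_rmorph (horner_eval c) d 'X k.
by rewrite /= /horner_eval hornerX.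
Qed.

(** The orbits of [o(i)] and of [0] differ by [o(i) ^ d] after one step, and
    [x - y] divides [x ^ d - y ^ d] in each later one. *)
Lemma crit_orbitD (R : comNzRingType) d (c : R) i k : (0 < k)%N ->
  exists s, crit_orbit d c (k + i) = crit_orbit d c k + crit_orbit d c i ^+ d * s.
Proof.
case: k => // k _; case: d => [|d].
  by exists 0; rewrite /crit_orbit /= !expr0 mulr0 addr0.
set o := crit_orbit _ _; elim: k => [|k [s IHk]].
  by exists 1; rewrite add1n mulr1 /o /crit_orbit /= expr0n add0r addrC.
exists (s * \sum_(l < d.+1) o (k.+1 + i)%N ^+ (d - l) * o k.+1 ^+ l).
have diff : o (k.+1 + i)%N - o k.+1 = o i ^+ d.+1 * s by rewrite IHk addrC addKr.
have := subrXX (o (k.+1 + i)%N) (o k.+1) d.+1; rewrite diff -mulrA => <-.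
have oS l : o l.+1 = o l ^+ d.+1 + c by [].
by rewrite [(k.+2 + i)%N]addSn !oS; ring.
Qed.

(** Each term [o(e * i)] is [o(i)] times a factor congruent to [1] modulo
    [o(i)]. *)
Lemma crit_orbitM (R : comNzRingType) d (c : R) i e : (0 < i)%N -> (0 < e)%N ->
  exists s, crit_orbit d c (e * i) = crit_orbit d c i + crit_orbit d c i ^+ d * s.
Proof.
move=> i_gt0; elim: e => // -[_ _|e IHe _].
  by exists 0; rewrite mulr0 addr0 mul1n.
have [s IHs] := IHe isT; rewrite mulSnr.
have ei_gt0 : (0 < e.+1 * i)%N by rewrite muln_gt0.
have [t ->] := crit_orbitD d c i ei_gt0.
by exists (s + t); rewrite IHs mulrDr addrA.
Qed.

(** Applied to the vanishing of the critical orbit, and to its reduction modulo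
    a prime ideal. *)
Lemma periodic_dvdn (S : pred nat) n :
    (forall i k, S i -> S (k + i)%N = S k) -> (0 < n)%N -> S n ->
  exists2 m, (0 < m)%N & forall k, S k = (m %| k)%N.
Proof.
move=> Sper n_gt0 Sn.
have exS : exists m, (0 < m)%N && S m by exists n; rewrite n_gt0.
case: (ex_minnP exS) => m /andP[m_gt0 Sm] m_min; exists m => // k.
have Smul q : S (k %% m + q * m)%N = S (k %% m)%N.
  by elim: q => [|q IHq]; rewrite ?addn0 // mulSnr addnA Sper.
rewrite {1}(divn_eq k m) addnC Smul /dvdn.
have [->|km_neq0] := eqVneq (k %% m)%N 0%N; first by rewrite -(Sper m) // Sm.
apply/negP => Skm; have := m_min (k %% m)%N.
by rewrite lt0n km_neq0 Skm leqNgt ltn_pmod // => /(_ isT).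
Qed.

(** * Moebius sums and roots of Gleason polynomials *)

Lemma moebius_mulp p m : prime p -> (0 < m)%N -> ~~ (p %| m)%N ->
  moebius (p * m) = - moebius m.
Proof.
move=> p_pr m_gt0 pNm; have p_gt0 := prime_gt0 p_pr.
have pNpr : p \notin primes m by rewrite mem_primes p_pr m_gt0.
have primes_pm : perm_eq (primes (p * m)) (p :: primes m).
  apply: uniq_perm; rewrite /= ?primes_uniq ?pNpr // => q.
  by rewrite primesM // primes_prime // !inE.
rewrite /moebius (perm_all _ primes_pm) (perm_size primes_pm) /=.
rewrite lognM // logn_prime // eqxx (lognE p m) p_pr m_gt0 (negPf pNm) addn0 /=.
rewrite (@eq_in_all _ _ (fun q => logn q m == 1%N)) => [|q q_m].
  by case: ifP; rewrite ?oppr0 // exprS mulN1r.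
rewrite lognM // logn_prime //; case: (q =P p) => [qp|//].
by rewrite -qp q_m in pNpr.
Qed.

Lemma moebius_sqr p m : prime p -> (0 < m)%N -> (p %| m)%N ->
  moebius (p * m) = 0.
Proof.
move=> p_pr m_gt0 p_m; have p_gt0 := prime_gt0 p_pr.
have pm_pr : p \in primes (p * m) by rewrite mem_primes p_pr muln_gt0 p_gt0 m_gt0 dvdn_mulr.
rewrite /moebius; case: allP => // /(_ p pm_pr).
by rewrite lognM // logn_prime // eqxx (lognE p m) p_pr m_gt0 p_m.
Qed.

(** The involution pairing a divisor [m] prime to [p] with [p * m], for a fixed
    prime factor [p], cancels the sum; multiples of [p ^ 2] contribute zero. *)
Lemma sum_moebius N : (1 < N)%N -> \sum_(m <- divisors N) moebius m = 0.
Proof.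
move=> N_gt1; have N_gt0 := ltnW N_gt1.
have [p p_pr p_N] : exists2 p, prime p & (p %| N)%N.
  by exists (pdiv N); rewrite ?pdiv_prime ?pdiv_dvd.
have p_gt0 := prime_gt0 p_pr.
have div_gt0 m : m \in divisors N -> (0 < m)%N.
  by rewrite -dvdn_divisors //; apply: dvdn_gt0.
rewrite (bigID (fun m => p %| m)%N) /= (bigID (fun m => p ^ 2 %| m)%N) /=.
rewrite big1_seq ?add0r => [|m /andP[/andP[_ ppm] m_N]]; last first.
  case/dvdnP: ppm => l m_def; have := div_gt0 m m_N.
  rewrite m_def mulnC expnS expn1 -mulnA => pl_gt0.
  have pl'_gt0 : (0 < p * l)%N by move: pl_gt0; rewrite muln_gt0 => /andP[].
  by rewrite moebius_sqr // dvdn_mulr.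
set D := [seq m <- divisors N | ~~ (p %| m)%N].
have pD : perm_eq [seq m <- divisors N | (p %| m)%N && ~~ (p ^ 2 %| m)%N]
                  [seq (p * m)%N | m <- D].
  apply: uniq_perm; first by rewrite filter_uniq ?divisors_uniq.
    rewrite map_inj_uniq ?filter_uniq ?divisors_uniq // => x y /eqP.
    by rewrite eqn_pmul2l // => /eqP.
  move=> m; rewrite mem_filter -dvdn_divisors //.
  apply/andP/mapP => [[/andP[/dvdnP[l ->] ppl] lp_N]|[l]].
    exists l; last by rewrite mulnC.
    rewrite mem_filter -dvdn_divisors // (dvdn_trans (dvdn_mulr _ _) lp_N) //.
    by rewrite andbT; apply: contra ppl => /dvdnP[q ->]; rewrite -mulnA dvdn_mull.
  rewrite mem_filter -dvdn_divisors // => /andP[pNl l_N] ->.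
  rewrite dvdn_mulr // expnS expn1 dvdn_pmul2l // pNl; split=> //.
  by rewrite Gauss_dvd ?p_N // prime_coprime.
rewrite -big_filter (perm_big _ pD) big_map -[X in _ + X]big_filter -/D.
rewrite -big_split big1_seq //= => m; rewrite mem_filter => /andP[pNm m_N].
by rewrite moebius_mulp ?addNr // div_gt0.
Qed.

Lemma crit_orbitX_monic d k : (1 < d)%N -> (0 < k)%N ->
  crit_orbit d ('X : {poly int}) k \is monic /\
  (1 < size (crit_orbit d ('X : {poly int}) k))%N.
Proof.
move=> d_gt1; case: k => // k _; set o := crit_orbit d 'X.
have oS l : o l.+1 = o l ^+ d + 'X by [].
elim: k => [|k [o_mon o_size]].
  rewrite oS /o /= expr0n gtn_eqF ?(ltnW d_gt1) // add0r.
  by rewrite monicX size_polyX.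
have size_od : (2 < size (o k.+1 ^+ d)%R)%N.
  have := size_exp (o k.+1) d; case: (size (o k.+1)) o_size => [//|[//|l]] _ /=.
  by move=> e; rewrite -ltn_predRL e mulSn (leq_trans d_gt1) // leq_addr.
rewrite oS monicE lead_coefDl ?size_polyX //.
by rewrite -monicE monic_exp // size_polyDl ?size_polyX // ltnW.
Qed.

(** The units of the local ring at the point [c], inside the fraction field of
    [Z[t]]. *)
Definition unit_at (F : fieldType) (c : F) (x : {fraction {poly int}}) : Prop :=
  exists A B : {poly int}, [/\ (map_poly (intr : int -> F) A).[c] != 0,
    (map_poly (intr : int -> F) B).[c] != 0 & x = tofrac A / tofrac B].

Section UnitAt.
Variables (F : fieldType) (c : F).

Lemma tofrac_neq0_at (A : {poly int}) :
  (map_poly (intr : int -> F) A).[c] != 0 -> tofrac A != 0.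
Proof. by rewrite tofrac_eq0; apply: contraNneq => ->; rewrite rmorph0 horner0. Qed.

Lemma unit_at1 : unit_at c 1.
Proof. by exists 1, 1; rewrite !rmorph1 hornerC oner_eq0 divr1. Qed.

Lemma unit_atM x y : unit_at c x -> unit_at c y -> unit_at c (x * y).
Proof.
case=> [A [B [A0 B0 ->]]] [A' [B' [A'0 B'0 ->]]]; exists (A * A'), (B * B').
by rewrite !rmorphM !hornerM !mulf_neq0 //= mulf_div.
Qed.

Lemma unit_atV x : unit_at c x -> unit_at c x^-1.
Proof. by case=> [A [B [A0 B0 ->]]]; exists B, A; rewrite invf_div. Qed.

Lemma unit_atXz x (e : int) : unit_at c x -> unit_at c (x ^ e).
Proof.
move=> ux; have uxn m : unit_at c (x ^+ m).
  by elim: m => [|m IHm]; [exact: unit_at1 | rewrite exprS; apply: unit_atM].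
by case: e => m; [exact: uxn | apply: unit_atV; exact: uxn].
Qed.

Lemma unit_at_tofrac (A : {poly int}) :
  unit_at c (tofrac A) <-> (map_poly (intr : int -> F) A).[c] != 0.
Proof.
split=> [[B [C [B0 C0 /eqP]]]|A0]; last first.
  by exists A, 1; rewrite !rmorph1 hornerC oner_eq0 divr1.
rewrite -(can2_eq (mulfK _) (divfK _)) ?tofrac_neq0_at // -rmorphM tofrac_eq.
by move/eqP => ABC; apply: contraNneq B0 => A0; rewrite -ABC rmorphM hornerM A0 mul0r.
Qed.

Lemma unit_at_prod (I : eqType) (s : seq I) (a : I -> {fraction {poly int}})
    (g : {fraction {poly int}}) (h e : I -> int) :
    g != 0 -> (forall k, k \in s -> exists2 u, unit_at c u & a k = g ^ h k * u) ->
  exists2 u, unit_at c u &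
    \prod_(k <- s) a k ^ e k = g ^ (\sum_(k <- s) h k * e k) * u.
Proof.
move=> g0; elim: s => [|k s IHs] as_.
  by exists 1; rewrite ?big_nil ?mulr1; [exact: unit_at1|].
have [u uu ak] := as_ k (mem_head _ _).
have [j js|v uv IH] := IHs; first by apply: as_; rewrite inE js orbT.
exists (u ^ e k * v); first by apply: unit_atM => //; apply: unit_atXz.
by rewrite !big_cons IH ak expfzDr // expfzMl exprz_exp mulrACA.
Qed.

End UnitAt.

Lemma crit_orbit_eq0_dvdn (F : fieldType) d (c : F) n : (0 < d)%N -> (0 < n)%N ->
    crit_orbit d c n = 0 ->
  exists2 m, (0 < m)%N & forall k, (crit_orbit d c k == 0) = (m %| k)%N.
Proof.
move=> d_gt0 n_gt0 on0.
apply: (@periodic_dvdn (fun k => crit_orbit d c k == 0) n) => //; last exact/eqP.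
move=> i [|k] /eqP oi; first by rewrite add0n oi.
have [s ->] := crit_orbitD d c i (ltn0Sn k).
by rewrite oi expr0n eqn0Ngt d_gt0 mul0r addr0.
Qed.

(** If the critical orbit has exact period [m] dividing [n], then [a_k] is
    [a_m] times a unit at [c] when [m] divides [k], and is a unit otherwise.
    Hence the order of vanishing of [G] is that of [a_m] times a sum of the
    Moebius function over the divisors of [n / m], which is zero for [m < n]. *)
Lemma gleason_root_period (F : fieldType) d n (G : {poly int}) (c : F) :
    (1 < d)%N -> (0 < n)%N -> is_gleason d n G ->
    root (map_poly (intr : int -> F) G) c ->
  crit_orbit d c n = 0 /\ forall i, (0 < i < n)%N -> crit_orbit d c i != 0.
Proof.
move=> d_gt1 n_gt0 GP rootG; have d_gt0 := ltnW d_gt1.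
have evo k : (map_poly (intr : int -> F) (crit_orbit d 'X k)).[c] = crit_orbit d c k.
  rewrite crit_orbit_rmorph /= map_polyX.
  by have := crit_orbit_rmorph (horner_eval c) d 'X k; rewrite /= /horner_eval hornerX.
have div_gt0 k : k \in divisors n -> (0 < k)%N.
  by rewrite -dvdn_divisors //; apply: dvdn_gt0.
have G_notunit : ~ unit_at c (tofrac G) by rewrite unit_at_tofrac -rootE rootG.
(* If the [a_k] are powers [g ^ h k] up to units at [c], then so is [G]; since
   it vanishes at [c], the total exponent of [g] is nonzero. *)
have factor g (h : nat -> int) : g != 0 ->
    (forall k, k \in divisors n ->
       exists2 u, unit_at c u & tofrac (crit_orbit d 'X k) = g ^ h k * u) ->
    \sum_(k <- divisors n) h k * moebius (n %/ k) != 0.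
  move=> g0 gh; apply/eqP => sum0; apply: G_notunit.
  have [|u uu] := @unit_at_prod F c _ (divisors n) (fun k => tofrac (a_poly d k))
                    g h (fun k => moebius (n %/ k)) g0.
    by move=> k kn; rewrite a_polyE ?(div_gt0 k) //; apply: gh.
  move=> prodE; have -> : tofrac G = u by rewrite (etrans GP prodE) sum0 mul1r.
  exact: uu.
have [k0 k0_gt0 ok0] : exists2 k, (0 < k)%N & crit_orbit d c k == 0.
  apply: contrapT => noroot.
  suff /eqP : \sum_(k <- divisors n) 0 * moebius (n %/ k) != 0.
    by apply; rewrite big1 // => k _; rewrite mul0r.
  apply: (factor 1 (fun=> 0)); first exact: oner_neq0.
  move=> k kn; exists (tofrac (crit_orbit d 'X k)); last by rewrite mul1r.
  rewrite unit_at_tofrac evo; apply/negP => ok.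
  by apply: noroot; exists k; rewrite ?div_gt0.
have [m m_gt0 om] := crit_orbit_eq0_dvdn d_gt0 k0_gt0 (eqP ok0).
have [am_mon _] := crit_orbitX_monic d_gt1 m_gt0.
set am := crit_orbit d 'X m in am_mon.
have am_neq0 : tofrac am != 0 by rewrite tofrac_eq0 monic_neq0.
have sum_neq0 : \sum_(k <- divisors n) (m %| k)%:R * moebius (n %/ k) != 0.
  apply: (factor (tofrac am)) => // k kn; have k_gt0 := div_gt0 k kn.
  have [/dvdnP[e k_em]|mNk] := boolP (m %| k)%N; last first.
    by exists (tofrac (crit_orbit d 'X k)); rewrite ?mul1r // unit_at_tofrac evo om.
  have e_gt0 : (0 < e)%N by move: k_gt0; rewrite k_em muln_gt0 => /andP[].
  have [s os] := crit_orbitM d ('X : {poly int}) m_gt0 e_gt0.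
  exists (tofrac (1 + am ^+ d.-1 * s)).
    rewrite unit_at_tofrac rmorphD rmorph1 rmorphM rmorphXn hornerD hornerC hornerM horner_exp.
    have -> : (map_poly intr am).[c] = 0 by apply/eqP; rewrite evo om.
    by rewrite expr0n -subn1 subn_eq0 leqNgt d_gt1 mul0r addr0 oner_eq0.
  by rewrite -rmorphM mulrDr mulr1 mulrA -exprS prednK // -os k_em.
have [n' n_def] : exists n', n = (n' * m)%N.
  apply/dvdnP; apply: contraR sum_neq0 => mNn.
  rewrite big1_seq // => k /andP[_ kn]; rewrite -dvdn_divisors // in kn.
  by case: (boolP (m %| k)%N) => [mk|]; rewrite ?mul0r //; case/negP: mNn; apply: dvdn_trans kn.
have n'_gt0 : (0 < n')%N by move: n_gt0; rewrite n_def muln_gt0 => /andP[].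
have [n'_gt1|] := ltnP 1 n'; last first.
  case: n' n'_gt0 n_def => [//|[|//]] _ n_def _; rewrite mul1n in n_def.
  split=> [|i /andP[i_gt0 i_n]]; first by apply/eqP; rewrite om n_def.
  by rewrite om -n_def gtnNdvd.
case/negP: sum_neq0; rewrite (bigID (fun k => m %| k)%N) /= addrC.
rewrite big1 ?add0r => [|k /negPf->]; last by rewrite mul0r.
under eq_bigr => k mk do rewrite mk mul1r.
have perm_div : perm_eq [seq k <- divisors n | (m %| k)%N]
                  [seq (n %/ l)%N | l <- divisors n'].
  apply: uniq_perm; first by rewrite filter_uniq ?divisors_uniq.
    rewrite map_inj_in_uniq ?divisors_uniq // => x y.
    rewrite -!dvdn_divisors // => xn yn nxy.
    have xn' : (x %| n)%N by rewrite n_def dvdn_mulr.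
    have yn' : (y %| n)%N by rewrite n_def dvdn_mulr.
    have nx_gt0 : (0 < n %/ x)%N by rewrite divn_gt0 ?(dvdn_gt0 n_gt0 xn') // dvdn_leq.
    by apply/eqP; rewrite -(eqn_pmul2l nx_gt0) divnK // nxy divnK.
  move=> k; rewrite mem_filter -dvdn_divisors //.
  apply/andP/mapP => [[/dvdnP[l ->] lm]|[l]].
    have l_n' : (l %| n')%N by rewrite n_def dvdn_pmul2r in lm.
    exists (n' %/ l)%N; first by rewrite -dvdn_divisors // dvdn_div.
    have l_gt0 := dvdn_gt0 n'_gt0 l_n'.
    by rewrite n_def -{1}(divnK l_n') -mulnA mulKn // divn_gt0 // dvdn_leq.
  rewrite -dvdn_divisors // => l_n' ->.
  by rewrite n_def -divn_mulAC // dvdn_mull // dvdn_pmul2r ?dvdn_div.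
rewrite -big_filter (perm_big _ perm_div) big_map -[X in _ == X](sum_moebius n'_gt1).
apply/eqP/eq_big_seq => l; rewrite -dvdn_divisors // => l_n'.
by rewrite divnA // ?mulKn // n_def dvdn_mulr.
Qed.

(** * Iterates modulo a prime *)

Definition intpoly_eval (R : comNzRingType) (c : R) : {poly int} -> R :=
  horner_eval c \o map_poly intr.

HB.instance Definition _ (R : comNzRingType) (c : R) :=
  GRing.RMorphism.on (intpoly_eval c).

Lemma intpoly_evalX (R : comNzRingType) (c : R) : intpoly_eval c 'X = c.
Proof. by rewrite /intpoly_eval /= /horner_eval map_polyX hornerX. Qed.

(** In characteristic [d] the orbit is [c + c ^ d + ... + c ^ (d ^ (k - 1))],
    and Frobenius shifts this sum. *)
Lemma crit_orbit_pchar (R : comNzRingType) d (c : R) k : d \in [pchar R] ->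
  crit_orbit d c k ^+ d + c = crit_orbit d c k + c ^+ (d ^ k).
Proof.
move=> d_char; have d_pr := pcharf_prime d_char.
have oS l : crit_orbit d c l.+1 = crit_orbit d c l ^+ d + c by [].
elim: k => [|k IHk]; first by rewrite expr0n eqn0Ngt prime_gt0.
rewrite {1}oS IHk exprDn_pchar ?pnatE // -exprM -expnSr.
by rewrite oS addrAC.
Qed.

Lemma iterpS (R : comNzRingType) d (c : R) k :
  iterp (unicrit d c) k.+1 = iterp (unicrit d c) k ^+ d + c%:P.
Proof. by rewrite /= /unicrit comp_polyD comp_Xn_poly comp_polyC. Qed.

Lemma map_iterp_unicrit (R S : comNzRingType) (f : {rmorphism R -> S}) d c k :
  map_poly f (iterp (unicrit d c) k) = iterp (unicrit d (f c)) k.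
Proof.
elim: k => [|k IHk]; first exact: map_polyX.
by rewrite !iterpS rmorphD rmorphXn /= map_polyC IHk.
Qed.

Lemma iterp_pchar (R : comNzRingType) d (c : R) k : d \in [pchar R] ->
  iterp (unicrit d c) k = 'X^(d ^ k) + (crit_orbit d c k)%:P.
Proof.
move=> d_char; have d_pr := pcharf_prime d_char.
have d_charP : d \in [pchar {poly R}] by rewrite (rmorph_pchar polyC).
elim: k => [|k IHk]; first by rewrite expn0 expr1 addr0.
by rewrite iterpS IHk exprDn_pchar ?pnatE // -exprM -expnSr rmorphD rmorphXn addrA.
Qed.

(** [(f^k) ^ d - a ^ d] divided by [f^k - a].  With [a = a_i] this is the
    polynomial [F_(k,i)], written without roots of unity. *)
Definition diff_quot (R : comNzRingType) d (c : R) (k : nat) (a : R) : {poly R} :=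
  \sum_(i < d) iterp (unicrit d c) k ^+ (d.-1 - i) * a%:P ^+ i.

Lemma diff_quotE (R : comNzRingType) d (c : R) k a :
  (iterp (unicrit d c) k - a%:P) * diff_quot d c k a =
  iterp (unicrit d c) k.+1 - (a ^+ d + c)%:P.
Proof. by rewrite -subrXX iterpS rmorphD rmorphXn /=; ring. Qed.

Lemma map_diff_quot (R S : comNzRingType) (f : {rmorphism R -> S}) d c k a :
  map_poly f (diff_quot d c k a) = diff_quot d (f c) k (f a).
Proof.
rewrite rmorph_sum; apply: eq_bigr => i _.
by rewrite rmorphM !rmorphXn /= map_iterp_unicrit map_polyC.
Qed.

(** The quotient is [((y + a) ^ d - a ^ d) / y] with [y = f^k - a], and here
    [y] is a power of ['X]. *)
Lemma diff_quot_pchar (R : idomainType) d (c : R) k : d \in [pchar R] ->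
  diff_quot d c k (crit_orbit d c k) = 'X^(d ^ k * d.-1).
Proof.
move=> d_char; have d_gt0 := prime_gt0 (pcharf_prime d_char).
have Xk_neq0 : 'X^(d ^ k) != 0 :> {poly R} by rewrite monic_neq0 ?monicXn.
apply: (mulfI Xk_neq0); have := diff_quotE d c k (crit_orbit d c k).
rewrite !iterp_pchar // -[_ ^+ d + c]/(crit_orbit d c k.+1) !addrK => ->.
by rewrite -exprD -mulnS prednK // -expnSr.
Qed.

Section ReductionModP.
Variables (d : nat) (d_pr : prime d).

Lemma reduction_eq0 (B : {poly int}) : map_poly (intr : int -> 'F_d) B = 0 ->
  exists E : {poly int}, B = d%:R * E.
Proof.
move=> B0; have /polyOver_dvdzP[E ->] : B \is a polyOver (dvdz d).
  apply/polyOverP => i; rewrite (dvdz_pcharf (pchar_Fp d_pr)).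
  by rewrite -coef_map B0 coef0.
by exists E; rewrite -mul_polyC -natz rmorph_nat.
Qed.

Variables (R : comNzRingType) (c : R).

Lemma coef_reduction_eq0 (P : {poly {poly int}}) i :
    (map_poly (map_poly (intr : int -> 'F_d)) P)`_i = 0 ->
  exists E, (map_poly (intpoly_eval c) P)`_i = d%:R * intpoly_eval c E.
Proof.
rewrite coef_map => /reduction_eq0[E PE]; exists E.
by rewrite coef_map /= PE rmorphM rmorph_nat.
Qed.

Let d_char : d \in [pchar {poly 'F_d}].
Proof. by rewrite (rmorph_pchar polyC) ?pchar_Fp. Qed.

Lemma coef_iterp_mod k i : (0 < i < d ^ k)%N ->
  exists E, (iterp (unicrit d c) k)`_i = d%:R * intpoly_eval c E.
Proof.
case/andP=> i_gt0 i_lt; rewrite -[X in unicrit d X](intpoly_evalX c).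
rewrite -map_iterp_unicrit; apply: coef_reduction_eq0.
rewrite map_iterp_unicrit iterp_pchar // coefD coefXn coefC.
by rewrite ltn_eqF // gtn_eqF // addr0.
Qed.

Lemma coef_diff_quot_mod k i : (i < d ^ k * d.-1)%N ->
  exists E, (diff_quot d c k (crit_orbit d c k))`_i = d%:R * intpoly_eval c E.
Proof.
move=> i_lt; rewrite -[c in diff_quot _ c](intpoly_evalX c).
rewrite -[c in crit_orbit _ c](intpoly_evalX c) -crit_orbit_rmorph -map_diff_quot.
apply: coef_reduction_eq0; rewrite map_diff_quot /= crit_orbit_rmorph.
by rewrite diff_quot_pchar // coefXn ltn_eqF.
Qed.

(** Modulo [d] the relation [a_n(c) = 0] reads
    [c + c ^ d + ... + c ^ (d ^ (n - 1)) = 0]; applying Frobenius and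
    subtracting, [c ^ (d ^ n) = c].  So the [n]-th power of Frobenius is the
    identity on [Z[c] / d], and in particular this ring is reduced. *)
Lemma frobenius_mod n : crit_orbit d c n = 0 -> forall B, exists E,
  intpoly_eval c B ^+ (d ^ n) = intpoly_eval c B + d%:R * intpoly_eval c E.
Proof.
move=> on0; have d_gt0 := prime_gt0 d_pr.
have ev0 B : map_poly (intr : int -> 'F_d) B = 0 ->
    exists E, intpoly_eval c B = d%:R * intpoly_eval c E.
  by move=> /reduction_eq0[E ->]; exists E; rewrite rmorphM rmorph_nat.
have [E1 cE1] : exists E, c ^+ (d ^ n) = c + d%:R * intpoly_eval c E.
  set o := crit_orbit d ('X : {poly int}) n.
  have [|E] := ev0 (o ^+ d + 'X - (o + 'X ^+ (d ^ n))).
    rewrite rmorphB !rmorphD !rmorphXn /= map_polyX crit_orbit_rmorph /= map_polyX.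
    by rewrite crit_orbit_pchar // subrr.
  rewrite rmorphB !rmorphD !rmorphXn /= intpoly_evalX crit_orbit_rmorph /=.
  rewrite intpoly_evalX on0 expr0n eqn0Ngt d_gt0 !add0r => cE.
  by exists (- E); rewrite rmorphN mulrN -cE; ring.
elim/poly_ind => [|B b [E IHB]].
  by exists 0; rewrite !rmorph0 mulr0 addr0 expr0n expn_eq0 eqn0Ngt d_gt0.
have [|E2 E2_def] := ev0 ((B * 'X + b%:P) ^+ (d ^ n) - (B ^+ (d ^ n) * 'X^(d ^ n) + b%:P)).
  rewrite rmorphB rmorphXn !rmorphD !rmorphM !rmorphXn /= map_polyX map_polyC /=.
  rewrite exprDn_pchar ?pnatX ?pnatE ?d_char // exprMn -polyC_exp.
  suff -> : (b%:~R : 'F_d) ^+ (d ^ n) = b%:~R by rewrite subrr.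
  elim: n {on0 IHB E1 cE1} => [|n IHn]; first by rewrite expr1.
  have := expf_card (b%:~R : 'F_d); rewrite card_Fp // => fermat.
  by rewrite expnSr exprM IHn.
move: E2_def; rewrite rmorphB rmorphXn !rmorphD !rmorphM !rmorphXn /= intpoly_evalX.
rewrite cE1 IHB; set b' := intpoly_eval c b%:P => E2_def.
exists (E2 + B * E1 + E * 'X + d%:R * E * E1).
rewrite !rmorphD !rmorphM rmorph_nat /= intpoly_evalX -/b'.
set u := intpoly_eval c B in E2_def *; set v := intpoly_eval c E in E2_def *.
set w := intpoly_eval c E1 in E2_def *; set x := intpoly_eval c E2 in E2_def *.
by move/(canRL (subrK _)): E2_def => ->; ring.
Qed.

End ReductionModP.

(** * Eisenstein's criterion over a valuation ring *)

Section Eisenstein.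
Variables (K : fieldType) (V : subringClosed K) (pi : K).
Hypothesis V_val : forall x, x \in V \/ x^-1 \in V.
Hypothesis piV_notV : pi^-1 \notin V.
Hypothesis V_max : forall x, x \in V -> x / pi \in V \/ x^-1 \in V.

(* Membership in the maximal ideal. *)
Let M x := x / pi \in V.

Let M_mull x y : x \in V -> M y -> M (x * y).
Proof. by move=> xV yM; rewrite /M -mulrA rpredM. Qed.

Let M_sum (I : Type) (s : seq I) (P : pred I) (F : I -> K) :
  (forall i, P i -> M (F i)) -> M (\sum_(i <- s | P i) F i).
Proof. by move=> FM; rewrite /M mulr_suml rpred_sum. Qed.

Let unit_inv x : x \in V -> ~~ M x -> x^-1 \in V.
Proof. by move=> xV /negPf xM; have [|//] := V_max xV; rewrite -/(M x) xM. Qed.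

Let unit_neq0 x : ~~ M x -> x != 0.
Proof. by apply: contraNneq => ->; rewrite /M mul0r rpred0. Qed.

Let unit_mul x y : x \in V -> y \in V -> ~~ M x -> ~~ M y -> ~~ M (x * y).
Proof.
move=> xV yV xM yM; apply: contra piV_notV => xyM.
have -> : pi^-1 = x^-1 * (y^-1 * (x * y / pi)).
  by rewrite mulrA -invfM mulKf ?mulf_neq0 ?unit_neq0.
by rewrite rpredM ?unit_inv // rpredM ?unit_inv.
Qed.

Let M1 : ~~ M 1. Proof. by rewrite /M mul1r. Qed.

(** In a valuation ring the coefficients are totally ordered by
    divisibility, so that one of them is a content. *)
Let primitive_scale (g : {poly K}) : g != 0 ->
  exists2 a, a != 0 & (forall i, g`_i / a \in V) /\ exists i, g`_i / a = 1.
Proof.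
move=> g_neq0; suff [a [a_neq0 a_g ag]] : exists a, [/\ a != 0, a \in (g : seq K) &
    forall b, b \in (g : seq K) -> b / a \in V].
  exists a => //; split=> [i|].
    have [i_lt|i_ge] := ltnP i (size g); first by rewrite ag ?mem_nth.
    by rewrite nth_default // mul0r rpred0.
  by exists (index a g); rewrite nth_index // divff.
have : has (fun x => x != 0) g.
  apply/hasP; exists (lead_coef g); last by rewrite lead_coef_eq0.
  by rewrite lead_coefE mem_nth // ltn_predL size_poly_gt0.
elim: (g : seq K) => //= b s IHs; have [s0 b0|/negPn s0 _] := boolP (~~ has (fun x => x != 0) s).
  exists b; rewrite mem_head; split=> // [|x].
    by move: b0; rewrite (negPf s0) orbF.
  rewrite inE => /predU1P[->|xs]; first by rewrite divff ?rpred1 //; move: b0; rewrite (negPf s0) orbF.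
  by move/hasPn: s0 => /(_ x xs); rewrite negbK => /eqP->; rewrite mul0r rpred0.
have [a [a_neq0 a_s as_]] := IHs s0.
have [ba|ba] := V_val (b / a).
  exists a; split=> // [|x]; rewrite inE ?a_s ?orbT //.
  by case/predU1P=> [->//|]; apply: as_.
have [b0|b_neq0] := eqVneq b 0.
  exists a; split=> // [|x]; rewrite inE ?a_s ?orbT //.
  by case/predU1P=> [->|]; [rewrite b0 mul0r rpred0|apply: as_].
exists b; rewrite mem_head; split=> // x; rewrite inE => /predU1P[->|xs].
  by rewrite divff ?rpred1.
have -> : x / b = (x / a) * (b / a)^-1.
  by rewrite invf_div mulrA divfK.
by rewrite rpredM ?as_.
Qed.

Let first_unit (g : {poly K}) : (forall i, g`_i \in V) -> (exists i, g`_i = 1) ->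
  exists i, [/\ (i < size g)%N, ~~ M g`_i & forall j, (j < i)%N -> M g`_j].
Proof.
move=> gV [i0 gi0]; have ex_unit : exists i, ~~ M g`_i by exists i0; rewrite gi0.
case: (ex_minnP ex_unit) => i gi i_min; exists i; split=> // [|j].
  by rewrite ltnNge; apply: contra gi => i_ge; rewrite nth_default // /M mul0r rpred0.
by rewrite ltnNge; apply: contraR => /i_min.
Qed.

(** Eisenstein's criterion over a valuation ring [V] whose maximal ideal is
    [pi * V].  Scale a factorization [f = g * h] so that [g] and [h] are
    primitive.  Modulo [pi] the product is a unit times a power of ['X], so
    the first unit coefficients of [g] and [h] are the leading ones; if both
    factors had positive degree the constant term of [f] would lie in
    [pi ^ 2 * V]. *)
Lemma eisenstein_valuation (f : {poly K}) : (1 < size f)%N -> f \is monic ->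
    (forall i, (i < (size f).-1)%N -> f`_i / pi \in V) ->
    f`_0 / (pi * pi) \notin V ->
  irreducible_poly f.
Proof.
move=> size_f f_mon f_low f0; split=> // q size_q q_f.
have /dvdpP[h f_hq] := q_f; have f_neq0 := monic_neq0 f_mon.
have h_neq0 : h != 0 by apply: contraNneq f_neq0 => h0; rewrite f_hq h0 mul0r.
have q_neq0 : q != 0 by apply: contraNneq f_neq0 => q0; rewrite f_hq q0 mulr0.
have size_hq : size f = ((size h).-1 + (size q).-1).+1.
  rewrite f_hq size_mul //; move: h_neq0 q_neq0; rewrite -!size_poly_gt0.
  by case: (size h) (size q) => [//|sh] [//|sq] _ _; rewrite addnS.
rewrite -dvdp_size_eqp // size_hq; have [->|size_h] := eqVneq (size h) 1%N.
  by rewrite add0n prednK // size_poly_gt0.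
have h_pos : (0 < (size h).-1)%N.
  by move: size_h (h_neq0); rewrite -size_poly_gt0; case: (size h) => [|[|]].
have q_pos : (0 < (size q).-1)%N.
  by move: size_q (q_neq0); rewrite -size_poly_gt0; case: (size q) => [|[|]].
case/negP: f0.
have [a a_neq0 [hV h1]] := primitive_scale h_neq0.
have [b b_neq0 [qV q1]] := primitive_scale q_neq0.
pose h' := a^-1 *: h; pose q' := b^-1 *: q.
have h'E i : h'`_i = h`_i / a by rewrite coefZ mulrC.
have q'E i : q'`_i = q`_i / b by rewrite coefZ mulrC.
have size_h' : size h' = size h by rewrite size_scale ?invr_neq0.
have size_q' : size q' = size q by rewrite size_scale ?invr_neq0.
pose lam := (a * b)^-1.
have hq'E : h' * q' = lam *: f.
  by rewrite f_hq /lam /h' /q' invfM -scalerA -scalerAl -scalerAr.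
have h'V i : h'`_i \in V by rewrite h'E.
have q'V i : q'`_i \in V by rewrite q'E.
have [|i [i_lt h'i i_min]] := first_unit h'V.
  by case: h1 => i hi; exists i; rewrite h'E.
have [|j [j_lt q'j j_min]] := first_unit q'V.
  by case: q1 => j qj; exists j; rewrite q'E.
rewrite size_h' in i_lt; rewrite size_q' in j_lt.
have hq'V l : (h' * q')`_l \in V by rewrite coefM rpred_sum // => m _; rewrite rpredM.
have lam_coef : lam = (h' * q')`_(size f).-1.
  by rewrite hq'E coefZ -lead_coefE (monicP f_mon) mulr1.
have lamV : lam \in V by rewrite lam_coef.
have hq'_unit : ~~ M (h' * q')`_(i + j).
  rewrite coefM (bigD1 (inord i)) //= inordK ?ltnS ?leq_addr // addKn.
  apply: contra (unit_mul (h'V i) (q'V j) h'i q'j) => sumM.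
  set rest := \sum_(l | _) _ in sumM; suff restM : M rest.
    by rewrite -[_ * _](addrK rest) /M mulrBl rpredB.
  apply: M_sum => l l_neq; have [l_lt|i_le] := ltnP l i.
    by rewrite mulrC; apply: M_mull => //; exact: i_min.
  have {l_neq} l_gt : (i < l)%N.
    rewrite ltn_neqAle i_le andbT; apply: contraNneq l_neq => il.
    by apply/eqP/val_inj; rewrite /= inordK // -?il // ltnS leq_addr.
  apply: M_mull => //; apply: j_min.
  by rewrite ltn_subLR ?ltn_add2r // -ltnS.
have [ij_lt|ij_ge] := ltnP (i + j) (size f).-1.
  by case/negP: hq'_unit; rewrite hq'E coefZ; apply: M_mull => //; exact: f_low.
have ijE : ((i + j)%N = (size f).-1).
  apply/eqP; rewrite eqn_leq ij_ge andbT size_hq /=.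
  by rewrite leq_add // -ltnS prednK // size_poly_gt0.
have i_gt0 : (0 < i)%N.
  have := ij_ge; rewrite size_hq /=; apply: contraTltn; rewrite leqn0 => /eqP->.
  rewrite -ltnNge add0n; apply: (@leq_ltn_trans (size q).-1); last by rewrite -[X in (X < _)%N]add0n ltn_add2r.
  by rewrite -ltnS prednK // size_poly_gt0.
have j_gt0 : (0 < j)%N.
  have := ij_ge; rewrite size_hq /=; apply: contraTltn; rewrite leqn0 => /eqP->.
  rewrite -ltnNge addn0; apply: (@leq_ltn_trans (size h).-1); last by rewrite -[X in (X < _)%N]addn0 ltn_add2l.
  by rewrite -ltnS prednK // size_poly_gt0.
have lam_unit : ~~ M lam by rewrite lam_coef -ijE.
have -> : f`_0 / (pi * pi) = lam^-1 * ((h'`_0 / pi) * (q'`_0 / pi)).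
  have -> : h'`_0 / pi * (q'`_0 / pi) = lam * f`_0 / (pi * pi).
    by rewrite mulf_div -coef0M hq'E coefZ.
  by rewrite -[lam * _ / _]mulrA mulKf // unit_neq0.
apply: rpredM; first exact: unit_inv.
by apply: rpredM; [exact: i_min|exact: j_min].
Qed.

End Eisenstein.

(** * Prime ideals and localization *)

Lemma prime_idealr_pack (A : comNzRingType) (S : {pred A}) :
  idealr_closed S -> prime_idealr_closed S -> exists p : prime_idealr A, p =i S.
Proof.
move=> S_ideal S_prime.
pose S' : prime_idealr A := HB.pack_for (prime_idealr A) (S : A -> bool)
  (isIdealr.Build A S S_ideal) (isPrimeIdealrClosed.Build A S S_prime).
by exists S'.
Qed.

Lemma prime_idealr_preim (A B : comNzRingType) (f : {rmorphism A -> B})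
  (P : prime_idealr B) : exists p : prime_idealr A, forall b, (b \in p) = (f b \in P).
Proof.
have [||p pE] := @prime_idealr_pack A [pred b | f b \in P].
- split; rewrite ?inE ?rmorph0 ?rmorph1 ?idealr0 ?idealr1 // => a b b'.
  rewrite !inE rmorphD rmorphM => bP b'P.
  by rewrite rpredD // idealMr.
- by move=> b b'; rewrite !inE rmorphM prime_idealrM.
by exists p => b; rewrite pE inE.
Qed.

(** Krull: an ideal containing [I] and maximal among those that avoid [1] is
    prime. *)
Lemma prime_idealr_exists (A : comNzRingType) (I : A -> Prop) :
    I 0 -> (forall a x y, I x -> I y -> I (a * x + y)) -> ~ I 1 ->
  exists p : prime_idealr A, forall x, I x -> x \in p.
Proof.
move=> I0 Icl I1.
pose ideal (X : set A) := [/\ (forall x, I x -> X x),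
  (forall a x y, X x -> X y -> X (a * x + y)) & ~ X 1].
(* The empty set is admitted because it is the union of the empty chain. *)
pose P (X : set A) := X = set0 \/ ideal X.
have [|X [PX X_max]] := @Zorn_bigcup A P.
  move=> F FP Ftot.
  have [[X0 [FX0 X0_neq0]]|F0] := pselect (exists X, F X /\ X <> set0); last first.
    left; apply/seteqP; split=> // x [X FX Xx]; apply: F0; exists X; split=> // X0.
    by rewrite X0 in Xx.
  have F_ideal X x : F X -> X x -> ideal X.
    by move=> FX Xx; case: (FP X FX) => // X_0; rewrite X_0 in Xx.
  right; split=> [x Ix|a x y [X FX Xx] [Y FY Yy]|[X FX X1]].
  - by case: (FP X0 FX0) => // -[IX0 _ _]; exists X0; last exact: IX0.
  - have [XY|YX] := Ftot X Y FX FY.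
      exists Y => //; have [_ Ycl _] := F_ideal Y y FY Yy.
      by apply: Ycl => //; apply: XY.
    exists X => //; have [_ Xcl _] := F_ideal X x FX Xx.
    by apply: Xcl => //; apply: YX.
  - by have [_ _] := F_ideal X 1 FX X1; apply.
have I_ideal : ideal (I : set A) by split.
have [IX Xcl X1] : ideal X.
  case: PX => // X0; case: (X_max (I : set A)); last by right.
  by rewrite X0; split=> // I_0; exact: (I_0 0 I0).
have X0 : X 0 by exact: IX.
have XM a x : X x -> X (a * x) by move=> Xx; rewrite -[_ * _]addr0; apply: Xcl.
have [||p pX] := @prime_idealr_pack A (fun x => `[< X x >]).
- split; first exact/asboolP.
    by apply/asboolP.
  by move=> a x y /asboolP Xx /asboolP Xy; apply/asboolP/Xcl.
- move=> u v /asboolP Xuv; rewrite !unfold_in; apply/orP.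
  apply: contrapT => /not_orP[Xu' Xv'].
  have Xu : ~ X u by move=> Xu; apply: Xu'; apply/asboolP.
  have Xv : ~ X v by move=> Xv; apply: Xv'; apply/asboolP.
  (* By maximality the ideal generated by [X] and [w] contains [1]. *)
  have gen w : ~ X w -> exists2 r, X r & exists a, r + a * w = 1.
    move=> Xw; apply: contrapT => no1.
    pose Y : set A := fun z => exists2 r, X r & exists a, z = r + a * w.
    apply: (X_max Y).
      split=> [x Xx|YX]; first by exists x => //; exists 0; rewrite mul0r addr0.
      by apply: Xw; apply: YX; exists 0 => //; exists 1; rewrite add0r mul1r.
    right; split=> [x Ix|a x y [r Xr [b ->]] [r' Xr' [b' ->]]|[r Xr [a ar]]].
    - by exists x; [exact: IX|exists 0; rewrite mul0r addr0].
    - by exists (a * r + r'); [exact: Xcl|exists (a * b + b'); ring].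
    - by apply: no1; exists r => //; exists a.
  have [r Xr [a ar]] := gen u Xu; have [r' Xr' [a' ar']] := gen v Xv.
  apply: X1; rewrite -[1]mulr1 -{1}ar -ar'.
  have -> : (r + a * u) * (r' + a' * v) =
      (r' + a' * v) * r + ((a * u) * r' + (a * a') * (u * v)) by ring.
  by apply: (Xcl) => //; apply: (Xcl) => //; apply: XM.
by exists p => x Ix; rewrite pX; apply/asboolP/IX.
Qed.

(** The localization of [ev A] at [p], as a subset of [K]. *)
Definition local_ring (A : comNzRingType) (K : fieldType) (ev : A -> K)
    (p : {pred A}) : {pred K} :=
  fun x => `[< exists s b, s \notin p /\ ev s * x = ev b >].

Section LocalSubring.
Variables (A : comNzRingType) (K : fieldType) (ev : {rmorphism A -> K}).
Variable p : prime_idealr A.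

Lemma local_ring_subring : subring_closed (local_ring ev p).
Proof.
split; first by apply/asboolP; exists 1, 1; rewrite idealr1 mulr1.
- move=> x y /asboolP[s [b [sp sx]]] /asboolP[t [b' [tp ty]]]; apply/asboolP.
  exists (s * t), (t * b - s * b'); rewrite prime_idealrM negb_or sp tp; split=> //.
  by rewrite rmorphB !rmorphM -sx -ty; ring.
- move=> x y /asboolP[s [b [sp sx]]] /asboolP[t [b' [tp ty]]]; apply/asboolP.
  exists (s * t), (b * b'); rewrite prime_idealrM negb_or sp tp; split=> //.
  by rewrite !rmorphM -sx -ty; ring.
Qed.

HB.instance Definition _ :=
  GRing.isSubringClosed.Build K (local_ring ev p) local_ring_subring.

End LocalSubring.

(** The hypothesis [frob] says that a power of Frobenius is the identity on
    [ev A] modulo [d].  For [b] in [p] it makes [b * (b ^ (M - 1) - 1)] a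
    multiple of [d], with second factor prime to [p]; so [d] generates the
    maximal ideal of the localization. *)
Section LocalValuation.
Variables (A : comNzRingType) (K : fieldType) (ev : {rmorphism A -> K}).
Variables (p : prime_idealr A) (d M : nat).
Hypothesis d_pr : prime d.
Hypothesis M_gt1 : (1 < M)%N.
Hypothesis ker_p : forall b, ev b = 0 -> b \in p.
Hypothesis d_p : d%:R \in p.
Hypothesis frob : forall b, exists e, ev b ^+ M = ev b + d%:R * ev e.
Hypothesis frac : forall x, exists b N, (0 < N)%N /\ x * N%:R = ev b.
Hypothesis char0 : forall N, (0 < N)%N -> (N%:R : K) != 0.

Local Notation V := (local_ring ev p).

Let d_neq0 : (d%:R : K) != 0.
Proof. by rewrite char0 // prime_gt0. Qed.

Lemma ev_neq0 s : s \notin p -> ev s != 0.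
Proof. by move=> sp; apply: contra sp => /eqP/ker_p. Qed.

Lemma local_ring_ev b : ev b \in V.
Proof. by apply/asboolP; exists 1, b; rewrite idealr1 rmorph1 mul1r. Qed.

Lemma eq_ev_p a b : ev a = ev b -> (a \in p) = (b \in p).
Proof.
move=> ab; have abp : a - b \in p by apply: ker_p; rewrite rmorphB ab subrr.
by rewrite -(subrK b a) rpredDl.
Qed.

Lemma local_ring_evV b : b \notin p -> (ev b)^-1 \in V.
Proof.
by move=> bp; apply/asboolP; exists b, 1; rewrite rmorph1 divff ?ev_neq0.
Qed.

Lemma local_ring_dV : (d%:R)^-1 \notin V.
Proof.
apply/negP => /asboolP[s [b [/negP sp sd]]]; apply: sp.
rewrite (@eq_ev_p _ (b * d%:R)) ?idealMr //.
by rewrite rmorphM rmorph_nat -sd divfK.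
Qed.

Let frob_p b : b \in p -> exists s e, s \notin p /\ ev s * ev b = d%:R * ev e.
Proof.
move=> bp; have [e be] := frob b.
exists (b ^+ M.-1 - 1), e; split; last first.
  rewrite rmorphB rmorph1 rmorphXn mulrBl mul1r -exprSr prednK ?(ltnW M_gt1) //.
  by rewrite be addrC addKr.
have bM : b ^+ M.-1 \in p.
  by case: M M_gt1 => [|[|m]] // _; rewrite exprSr idealMr.
by rewrite rpredBl // idealr1.
Qed.

Lemma local_ring_max x : x \in V -> x / d%:R \in V \/ x^-1 \in V.
Proof.
case/asboolP => s [b [sp sx]]; have [bp|bp] := boolP (b \in p); last first.
  right; apply/asboolP; exists b, s; rewrite bp -sx; split=> //.
  by rewrite mulfK //; apply: contraNneq (ev_neq0 bp) => x0; rewrite -sx x0 mulr0.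
left; have [t [e [tp te]]] := frob_p bp; apply/asboolP; exists (t * s), e.
rewrite prime_idealrM negb_or tp sp; split=> //.
by rewrite rmorphM mulrA -[ev t * _ * x]mulrA sx te mulrC mulKf.
Qed.

Let nat_p N : (N%:R \in p) = (d %| N)%N.
Proof.
apply/idP/idP => [Np|/dvdnP[q ->]]; last by rewrite natrM idealMr.
apply: contraFT (idealr1 p) => dN.
have : coprime d N by rewrite prime_coprime.
case/coprimeP; rewrite ?prime_gt0 // => -[u v] /= uv.
have vu : (v * N <= u * d)%N by rewrite ltnW // -subn_gt0 uv.
by rewrite -[1]/(1%:R) -uv natrB // !natrM rpredB // idealMr.
Qed.

(** The induction is on an integer multiple of [b]: dividing [b] by [d]
    divides this integer by [d], so the process stops. *)
Let factor_d N : (0 < N)%N -> forall s b b', s \notin p ->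
    ev b * ev b' = ev s * N%:R ->
  exists k t e, [/\ t \notin p, e \notin p & ev t * ev b = d%:R ^+ k * ev e].
Proof.
elim/ltn_ind: N => N IHN N_gt0 s b b' sp bb'.
have [bp|bp] := boolP (b \in p); last first.
  by exists 0%N, 1, b; rewrite idealr1 bp rmorph1 expr0.
have : s * N%:R \in p.
  by rewrite (@eq_ev_p _ (b * b')) ?rmorphM ?rmorph_nat // mulrC idealMr.
rewrite prime_idealrM (negPf sp) nat_p => /dvdnP[N1 N_def].
have N1_gt0 : (0 < N1)%N by move: N_gt0; rewrite N_def muln_gt0 => /andP[].
have [s1 [e [s1p s1e]]] := frob_p bp.
have N1_lt : (N1 < N)%N by rewrite N_def ltn_Pmulr // prime_gt1.
have [||k [t [e' [tp e'p te]]]] := IHN N1 N1_lt N1_gt0 (s1 * s) e b'.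
- by rewrite prime_idealrM negb_or s1p.
- apply: (mulfI d_neq0); rewrite mulrA -s1e -mulrA bb' rmorphM N_def natrM; ring.
exists k.+1, (t * s1), e'; split=> //; first by rewrite prime_idealrM negb_or tp.
by rewrite rmorphM -mulrA s1e mulrCA te exprS mulrA.
Qed.

(** By [frac] every element of [K] is a quotient of two nonzero elements of
    [ev A], and each of these is a power of [d] up to units. *)
Lemma local_ring_val x : x \in V \/ x^-1 \in V.
Proof.
have [->|x_neq0] := eqVneq x 0; first by left; rewrite rpred0.
have ord_ev b : ev b != 0 -> exists k t e,
    [/\ t \notin p, e \notin p & ev t * ev b = d%:R ^+ k * ev e].
  move=> b_neq0; have [b' [N [N_gt0 bN]]] := frac (ev b)^-1.
  apply: (@factor_d N N_gt0 1 b b'); first by rewrite idealr1.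
  by rewrite -bN mulVKf // rmorph1 mul1r.
have [b [N [N_gt0 xN]]] := frac x.
have [|k [t [e [tp ep te]]]] := ord_ev b.
  by rewrite -xN mulf_neq0 ?char0.
have [|l [t' [e' [t'p e'p te']]]] := ord_ev N%:R.
  by rewrite rmorph_nat char0.
have x_def : ev (t * e') * (d%:R ^+ l * x) = d%:R ^+ k * ev (t' * e).
  rewrite !rmorphM; rewrite rmorph_nat in te'.
  transitivity (ev t * x * (ev t' * N%:R)); first by rewrite te'; ring.
  by rewrite [RHS]mulrCA -te -xN; ring.
have [lk|kl] := leqP l k.
  left; apply/asboolP; exists (t * e'), (d%:R ^+ (k - l) * (t' * e)).
  rewrite prime_idealrM negb_or tp e'p; split=> //.
  apply: (mulfI (expf_neq0 l d_neq0)); rewrite mulrCA x_def.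
  by rewrite [ev (d%:R ^+ _ * _)]rmorphM rmorphXn rmorph_nat mulrA -exprD subnKC.
right; apply/asboolP; exists (t' * e), (d%:R ^+ (l - k) * (t * e')).
rewrite prime_idealrM negb_or t'p ep; split=> //.
apply: (mulfI (expf_neq0 k d_neq0)); rewrite [LHS]mulrA -x_def.
rewrite [ev (d%:R ^+ _ * _)]rmorphM rmorphXn rmorph_nat !mulrA -exprD subnKC ?(ltnW kl) //.
by rewrite mulfK // mulrC.
Qed.

End LocalValuation.

(** * Iterates of a unicritical polynomial over a field *)

Section UnicritPolynomials.
Variables (K : fieldType) (d : nat) (c : K).
Hypothesis d_gt1 : (1 < d)%N.
Local Notation f := (unicrit d c).

Lemma iterpD k l : iterp f (k + l) = iterp f k \Po iterp f l.
Proof.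
elim: k => [|k IHk]; first by rewrite comp_polyX.
by rewrite addSn !iterpS comp_polyD comp_polyC IHk rmorphXn.
Qed.

Lemma iterp_sub_monic k a :
  iterp f k - a%:P \is monic /\ size (iterp f k - a%:P) = (d ^ k).+1.
Proof.
have subC (p : {poly K}) m b : (0 < m)%N -> p \is monic /\ size p = m.+1 ->
    p - b%:P \is monic /\ size (p - b%:P) = m.+1.
  move=> m_gt0 [p_mon size_p].
  have b_lt : (size (- b%:P) < size p)%N.
    by rewrite size_polyN size_p ltnS (leq_trans (size_polyC_leq1 b)).
  by rewrite monicE lead_coefDl // size_polyDl.
have d_gt0 := ltnW d_gt1.
elim: k a => [|k IHk] a; first by apply: (subC); rewrite ?monicX ?size_polyX.
apply: (subC); first by rewrite expn_gt0 d_gt0.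
rewrite iterpS -[c%:P]opprK -polyCN; apply: (subC); first by rewrite expn_gt0 d_gt0.
have [] := IHk 0; rewrite subr0 => f_mon size_f; split; first exact: monic_exp.
rewrite -[LHS]prednK ?size_poly_gt0 ?monic_neq0 ?monic_exp //.
by rewrite size_exp size_f -expnSr.
Qed.

Lemma size_iterp k : size (iterp f k) = (d ^ k).+1.
Proof. by have [_] := iterp_sub_monic k 0; rewrite subr0. Qed.

Lemma diff_quot_monic k a :
  diff_quot d c k a \is monic /\ size (diff_quot d c k a) = (d ^ k * d.-1).+1.
Proof.
have [f_mon size_f] := iterp_sub_monic k a.
have [g_mon size_g] := iterp_sub_monic k.+1 (a ^+ d + c).
have D_mon : diff_quot d c k a \is monic.
  by rewrite -(monicMl _ f_mon) diff_quotE.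
split=> //; move: size_g; rewrite -diff_quotE size_Mmonic ?monic_neq0 // size_f.
rewrite addSn /= => size_D; apply/eqP.
by rewrite -(eqn_add2l (d ^ k)) size_D addnS -mulnS prednK ?(ltnW d_gt1) // expnSr.
Qed.

Lemma diff_quot_comp k l a :
  diff_quot d c (k + l) a = diff_quot d c k a \Po iterp f l.
Proof.
rewrite /diff_quot raddf_sum; apply: eq_bigr => i _ /=.
by rewrite comp_polyM !rmorphXn /= comp_polyC iterpD.
Qed.

Lemma coef0_iterp k : (iterp f k)`_0 = crit_orbit d c k.
Proof.
elim: k => [|k IHk]; first by rewrite coefX.
rewrite iterpS coefD coefC eqxx /= -IHk.
by rewrite -!horner_coef0 horner_exp.
Qed.

Lemma coef0_diff_quot k :
  (diff_quot d c k (crit_orbit d c k))`_0 = d%:R * crit_orbit d c k ^+ d.-1.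
Proof.
rewrite -horner_coef0 horner_sum.
under eq_bigr => i _ do rewrite hornerM !horner_exp hornerC horner_coef0 coef0_iterp -exprD.
rewrite (eq_bigr (fun=> crit_orbit d c k ^+ d.-1)) => [|i _]; last first.
  by rewrite subnK // -ltnS prednK ?(ltnW d_gt1).
by rewrite sumr_const card_ord mulr_natl.
Qed.

(** Homogenization of [\prod_(j < d) ('X - zeta ^ j) = 'X^d - 1]. *)
Lemma diff_quot_fac (zeta : K) k a : prime d -> zeta ^+ d = 1 -> zeta != 1 ->
    a != 0 ->
  diff_quot d c k a = \prod_(1 <= j < d) (iterp f k - (zeta ^+ j * a)%:P).
Proof.
move=> d_pr zeta_d zeta_neq1 a_neq0; set y := iterp f k.
have zeta_prim : d.-primitive_root zeta.
  have [m m_prim m_d] := prim_order_exists (ltnW d_gt1) zeta_d.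
  have /orP[/eqP m1|/eqP<-//] := (primeP d_pr).2 m m_d.
  by move: zeta_neq1; rewrite -[zeta]expr1 -m1 prim_expr_order ?eqxx.
have y_neq0 : y - a%:P != 0 by rewrite monic_neq0 //; case: (iterp_sub_monic k a).
apply: (mulfI y_neq0).
transitivity (\prod_(0 <= j < d) (y - (zeta ^+ j * a)%:P)); last first.
  by rewrite big_ltn ?(ltnW d_gt1) // expr0 mul1r.
rewrite -subrXX -/y.
have /(congr1 (fun p => p \Po (a^-1 *: y))) := factor_Xn_sub_1 zeta_prim.
rewrite rmorph_prod rmorphB rmorph1 rmorphXn /= comp_polyX.
under eq_bigr => j _ do rewrite comp_polyB comp_polyX comp_polyC.
move/(congr1 (fun p => (a ^+ d)%:P * p)).
rewrite mulrBr mulr1 -[(a ^+ d)%:P * _ ^+ d]/(_) rmorphXn /=.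
rewrite -exprMn mul_polyC scalerA divff // scale1r => <-.
rewrite big_mkord [RHS]big_mkord -[d in a%:P ^+ d]card_ord -prodr_const -big_split /=.
apply: eq_bigr => j _.
by rewrite mulrBr mul_polyC scalerA divff // scale1r -polyCM mulrC.
Qed.

Lemma crit_orbit_period n : crit_orbit d c n = 0 -> forall i k, (0 < i)%N ->
  crit_orbit d c (i + n * k) = crit_orbit d c i.
Proof.
move=> on0 i k i_gt0; elim: k => [|k IHk]; first by rewrite muln0 addn0.
have pos : (0 < i + n * k)%N by rewrite addn_gt0 i_gt0.
have [s] := crit_orbitD d c n pos.
by rewrite mulnSr addnA IHk on0 expr0n eqn0Ngt (ltnW d_gt1) mul0r addr0.
Qed.

(** One step replaces [f^(k+1) - a_(i+1)] by [(f^k - a_i) * F_(k,i)]; since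
    [a_n = 0], the descent starts at [f^k]. *)
Lemma iterp_telescope n k m : crit_orbit d c n = 0 -> (m < n)%N -> (m <= k)%N ->
  iterp f k = (\prod_(1 <= i < m.+1) diff_quot d c (k - i) (crit_orbit d c (n - i)))
              * (iterp f (k - m) - (crit_orbit d c (n - m))%:P).
Proof.
move=> on0; elim: m => [|m IHm] m_n m_k.
  by rewrite big_nil mul1r !subn0 on0 subr0.
rewrite big_nat_recr //= -mulrA [X in _ * X]mulrC diff_quotE IHm ?(ltnW m_n) ?(ltnW m_k) //.
have subS l : (m < l)%N -> (l - m)%N = (l - m.+1).+1 by move=> ml; rewrite subnSK.
by rewrite (subS k) // (subS n) // ltnW.
Qed.

(** A descent of [n - 1] steps ends at [f^(k - n + 1) - a_1 = (f^(k - n)) ^ d],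
    so each further round multiplies the exponents by [d]. *)
Lemma iterp_factor n q r : (0 < n)%N -> crit_orbit d c n = 0 -> (r < n)%N ->
  iterp f (n * q + r) =
  (\prod_(0 <= j < q) \prod_(1 <= i < n)
     diff_quot d c (n * q + r - n * j - i) (crit_orbit d c (n - i)) ^+ (d ^ j)%N) *
  (('X - (crit_orbit d c (n - r))%:P) *
    \prod_(1 <= i < r.+1) diff_quot d c (r - i) (crit_orbit d c (n - i))) ^+ (d ^ q)%N.
Proof.
move=> n_gt0 on0 r_n; have d_gt0 := ltnW d_gt1; elim: q => [|q IHq].
  rewrite muln0 add0n big_nil mul1r expr1 (iterp_telescope on0 r_n (leqnn r)).
  by rewrite subnn mulrC.
have kE : (n * q.+1 + r = n + (n * q + r))%N by rewrite mulnS addnA.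
have n1_n : (n.-1 < n)%N by rewrite prednK.
have n1_k : (n.-1 <= n + (n * q + r))%N by rewrite (leq_trans (ltnW n1_n)) // leq_addr.
have subn_n1 l : (n + l - n.-1 = l.+1)%N.
  by rewrite -{1}(prednK n_gt0) addSn -addnS addKn.
rewrite kE (iterp_telescope on0 n1_n n1_k) prednK // subn_n1.
have -> : (n - n.-1)%N = 1%N by rewrite -[n in (n - _)%N]addn0 subn_n1.
rewrite iterpS {2}/crit_orbit /= expr0n eqn0Ngt d_gt0 add0r addrK.
rewrite big_nat_recl // [X in _ = X * _ * _]/=; rewrite -mulrA; congr (_ * _).
  by apply: eq_bigr => i _; rewrite muln0 subn0 expr1.
rewrite IHq exprMn -exprM -expnSr; congr (_ * _).
rewrite -prodrXl; apply: eq_bigr => j _; rewrite -prodrXl; apply: eq_bigr => i _.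
by rewrite -exprM -expnSr mulnS subnDA addKn.
Qed.

End UnicritPolynomials.

(** A factorization of [p] composes to one of [p \Po g], with degrees scaled. *)
Lemma irreducible_comp (K : fieldType) (p g : {poly K}) :
  (1 < size g)%N -> irreducible_poly (p \Po g) -> irreducible_poly p.
Proof.
move=> size_g [size_pg irr_pg]; have g_gt0 : (0 < (size g).-1)%N by case: (size g) size_g => [|[|]].
have p_neq0 : p != 0 by apply: contraTneq size_pg => ->; rewrite comp_poly0 size_poly0.
have size_compE (q : {poly K}) : (size (q \Po g)).-1 = ((size q).-1 * (size g).-1)%N.
  exact: size_comp_poly.
split=> [|q size_q q_p].
  have : (0 < (size (p \Po g)).-1)%N by case: (size _) size_pg => [|[|]].
  by rewrite size_compE muln_gt0 => /andP[]; case: (size p) => [|[|]].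
have q_neq0 : q != 0 by apply: contraTneq q_p => ->; rewrite dvd0p.
have q1_gt0 : (0 < (size q).-1)%N.
  by move: size_q q_neq0; rewrite -size_poly_gt0; case: (size q) => [|[|]].
have /irr_pg qg_pg : size (q \Po g) != 1%N.
  by apply/eqP => size_qg; have := size_compE q; rewrite size_qg => /esym/eqP; rewrite muln_eq0 !eqn0Ngt q1_gt0 g_gt0.
have /qg_pg/eqp_size eq_size : q \Po g %| p \Po g by apply: dvdp_comp_poly.
rewrite -dvdp_size_eqp //; have := size_compE q; rewrite eq_size size_compE.
move/eqP; rewrite eqn_pmul2r // => /eqP eq_size'.
have sizeS (u : {poly K}) : u != 0 -> size u = (size u).-1.+1.
  by rewrite -size_poly_gt0 => /prednK->.
by rewrite (sizeS q) // (sizeS p) // eq_size'.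
Qed.

(** * The valuation at a prime above [d] *)

Lemma rmorph_intpoly_eval (R S : comNzRingType) (g : {rmorphism R -> S}) c B :
  g (intpoly_eval c B) = intpoly_eval (g c) B.
Proof.
rewrite /intpoly_eval /= /horner_eval -horner_map -map_poly_comp.
by congr _.[_]; apply: eq_map_poly => z /=; rewrite rmorph_int.
Qed.

(** When [x ^ -1] is in [V], dividing an integral equation of degree [N + 1] by
    [x ^ N] expresses [x] as a polynomial in [x ^ -1]. *)
Lemma valuation_ring_integral (K : fieldType) (V : subringClosed K) :
    (forall x, x \in V \/ x^-1 \in V) ->
  forall x, integralOver (intr : int -> K) x -> x \in V.
Proof.
move=> V_val x [q q_mon qx]; have [//|xV] := V_val x.
have [->|x_neq0] := eqVneq x 0; first exact: rpred0.
have int_V (z : int) : z%:~R \in V by rewrite rpred_int.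
set q' := map_poly _ q in qx.
have q'_mon : q' \is monic by apply: monic_map.
case size_q : (size q') (monic_neq0 q'_mon) => [|[|N]].
- by rewrite -size_poly_gt0 size_q.
- move=> _; have /size_poly1P[a a_neq0 q'E] : size q' == 1%N by rewrite size_q.
  by move: qx a_neq0; rewrite q'E rootC => ->.
move=> _; move: qx; rewrite rootE horner_coef size_q big_ord_recr /=.
have -> : q'`_N.+1 = 1 by move/monicP: q'_mon; rewrite lead_coefE size_q.
rewrite mul1r addrC addr_eq0 exprSr => /eqP xN.
have -> : x = - \sum_(i < N.+1) q'`_i * x^-1 ^+ (N - i).
  apply: (mulfI (expf_neq0 N x_neq0)); rewrite xN mulrN mulr_sumr.
  congr (- _); apply: eq_bigr => i _; rewrite mulrCA; congr (_ * _).
  have i_N : (i <= N)%N by rewrite -ltnS.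
  rewrite -{2}(subnK i_N) [(N - i + i)%N]addnC exprD -mulrA -exprMn divff //.
  by rewrite expr1n mulr1.
by rewrite rpredN rpred_sum // => i _; rewrite rpredM ?rpredX // coef_map int_V.
Qed.

Section IdealPowers.
Variables (R : comNzRingType) (P : idealr R).

Lemma in_ideal_powD m x y :
  in_ideal_pow P m x -> in_ideal_pow P m y -> in_ideal_pow P m (x + y).
Proof.
case: m => //= m [s [sP ->]] [t [tP ->]]; exists (s ++ t); rewrite big_cat; split=> // w.
by rewrite mem_cat => /orP[/sP|/tP].
Qed.

Lemma in_ideal_powS m u x :
  u \in P -> in_ideal_pow P m x -> in_ideal_pow P m.+1 (u * x).
Proof.
by move=> uP xP; exists [:: (u, x)]; rewrite big_seq1; split=> // w; rewrite inE => /eqP->.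
Qed.

Lemma in_ideal_powX m u x : u \in P -> in_ideal_pow P m (u ^+ m * x).
Proof.
by move=> uP; elim: m => // m IHm; rewrite exprS -mulrA; apply: in_ideal_powS.
Qed.

End IdealPowers.

Section NumberField.
Variables (K : fieldExtType rat) (c : K).

Lemma natr_neq0 N : (0 < N)%N -> (N%:R : K) != 0.
Proof.
by rewrite lt0n; apply: contra; rewrite ((pcharf0P K).1 _ N) // => q; rewrite pchar_lalg pchar_num.
Qed.

Lemma generator_frac : <<1; c>>%VS = fullv -> forall x : K,
  exists b N, (0 < N)%N /\ x * N%:R = intpoly_eval c b.
Proof.
move=> K_gen x; have /Fadjoin1_polyP[q ->] : x \in <<1; c>>%VS by rewrite K_gen memvf.
have [b [a a_neq0 ->]] := rat_poly_scale q.
have aE (r : {poly int}) : (map_poly (in_alg K) (map_poly intr r)).[c] = intpoly_eval c r.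
  rewrite -map_poly_comp /intpoly_eval /= /horner_eval.
  by congr _.[_]; apply: eq_map_poly => z /=; rewrite scaler_int.
exists (sgz a *: b), `|a|%N; rewrite absz_gt0; split=> //.
have absE : (`|a|%N%:R : K) = (sgz a)%:~R * a%:~R.
  by rewrite -intrM -abszEsg pmulrn.
have aV : GRing.in_alg K a%:~R^-1 * a%:~R = 1.
  have -> : (a%:~R : K) = (a%:~R : rat) *: 1 by rewrite scaler_int.
  by rewrite /= -scalerAl mul1r scalerA mulVf ?scale1r // intr_eq0.
rewrite map_polyZ hornerZ aE absE mulrACA [_ * a%:~R]mulrC.
rewrite -[sgz a *: b]mul_polyC rmorphM /= [X in _ = X * _]/intpoly_eval /= /horner_eval map_polyC hornerC /=.
by rewrite mulrA [X in X * _]mulrAC aV mul1r.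
Qed.

(** A monic integer polynomial vanishing at [1 / d], cleared of denominators,
    reads [1 + d * z = 0] with [z] an integer. *)
Lemma prime_not_inverted d x : prime d -> integralOver (intr : int -> K) x ->
  d%:R * x <> 1.
Proof.
move=> d_pr [q q_mon qx] dx1; have d_gt0 := prime_gt0 d_pr.
have q_size : size q = (size q).-1.+1 by rewrite prednK // size_poly_gt0 monic_neq0.
have map_size : size (map_poly (intr : int -> K) q) = size q.
  by rewrite size_map_poly_id0 // (monicP q_mon) oner_eq0.
set N := (size q).-1 in q_size.
have arith l m : (m < l)%N -> ((l.-1 - m).+1 + m)%N = l.
  by case: l => // l; rewrite ltnS /= addSn => /subnK->.
pose z := \sum_(i < N) q`_i * d%:Z ^+ (N.-1 - i).
have : (1 + d%:Z * z)%:~R = 0 :> K.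
  move: qx; rewrite rootE horner_coef map_size q_size big_ord_recr /= => /eqP.
  have -> : (map_poly (intr : int -> K) q)`_N = 1.
    by rewrite coef_map -lead_coefE (monicP q_mon).
  move/(congr1 (fun y => d%:R ^+ N * y)); rewrite mulr0 mulrDr mul1r -exprMn dx1 expr1n.
  move=> <-; rewrite rmorphD rmorph1 addrC; congr (_ + _).
  rewrite rmorphM rmorph_sum !mulr_sumr; apply: eq_bigr => i _.
  rewrite coef_map rmorphM rmorphXn /= -pmulrn.
  have dNx : d%:R ^+ N * x ^+ i = d%:R ^+ (N.-1 - i) * d%:R.
    have -> : (d%:R : K) ^+ N = d%:R ^+ (N.-1 - i) * d%:R * d%:R ^+ i.
      by rewrite -exprSr -exprD arith.
    by rewrite -[LHS]mulrA -exprMn dx1 expr1n mulr1.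
  by rewrite [RHS]mulrCA dNx; ring.
have intK (y : int) : y%:~R = 0 :> K -> y = 0.
  case: y => y; rewrite ?NegzE ?rmorphN /= -pmulrn.
    by case: y => // y /eqP; rewrite (negPf (natr_neq0 _)).
  by move/eqP; rewrite oppr_eq0 (negPf (natr_neq0 _)).
move/intK => z0; have : (d %| 1)%Z.
  by apply/dvdzP; exists (- z); apply/eqP; rewrite mulNr mulrC -addr_eq0 z0.
by rewrite dvdzE /= dvdn1 => /eqP d1; rewrite d1 in d_pr.
Qed.

End NumberField.

Section PeriodicParameter.
Variables (K : fieldExtType rat) (c : K) (d n : nat).
Hypothesis K_gen : <<1; c>>%VS = fullv.
Hypothesis d_pr : prime d.
Hypothesis n_gt0 : (0 < n)%N.
Hypothesis on0 : crit_orbit d c n = 0.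

Let d_gt1 := prime_gt1 d_pr.
Let d_gt0 := prime_gt0 d_pr.

Let dn_gt1 : (1 < d ^ n)%N.
Proof. by rewrite -(expn0 d) ltn_exp2l. Qed.

Section AtPrime.
Variable p : prime_idealr {poly int}.
Hypothesis ker_p : forall b, intpoly_eval c b = 0 -> b \in p.
Hypothesis d_p : d%:R \in p.

Local Notation V := (local_ring (intpoly_eval c) p).

Lemma periodic_local_val x : x \in V \/ x^-1 \in V.
Proof.
exact: (local_ring_val d_pr dn_gt1 ker_p d_p (frobenius_mod d_pr on0)
         (generator_frac K_gen) (@natr_neq0 K)).
Qed.

Lemma periodic_local_max x : x \in V -> x / d%:R \in V \/ x^-1 \in V.
Proof.
exact: (local_ring_max d_pr dn_gt1 ker_p (frobenius_mod d_pr on0) (@natr_neq0 K)).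
Qed.

Lemma periodic_local_dV : (d%:R)^-1 \notin V.
Proof. exact: (local_ring_dV d_pr ker_p d_p (@natr_neq0 K)). Qed.

Lemma local_eisenstein (f : {poly K}) : (1 < size f)%N -> f \is monic ->
    (forall i, (i < (size f).-1)%N -> f`_i / d%:R \in V) ->
    f`_0 / (d%:R * d%:R) \notin V ->
  irreducible_poly f.
Proof.
apply: eisenstein_valuation; [exact: periodic_local_val|exact: periodic_local_dV|exact: periodic_local_max].
Qed.

(** [d] is not invertible at [p]. *)
Lemma at_prime_unit b : b \notin p -> intpoly_eval c b / d%:R \notin V.
Proof.
move=> bp; apply: contra periodic_local_dV => bd.
rewrite -[d%:R^-1](mulKf (ev_neq0 ker_p bp)) rpredM //.
exact: (local_ring_evV ker_p bp).
Qed.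

(** Let [m] be the period of the orbit modulo [p].  It divides [n], and [a_n] is
    [a_m] times an element congruent to [1] modulo [p].  Since [a_n(c) = 0],
    this forces [a_m(c) = 0], that is [m = n]. *)
Lemma crit_orbit_notin_prime : (forall i, (0 < i < n)%N -> crit_orbit d c i != 0) ->
  forall i, (0 < i < n)%N -> crit_orbit d 'X i \notin p.
Proof.
move=> o_neq0 i /andP[i_gt0 i_n]; pose o := crit_orbit d ('X : {poly int}).
have evo k : intpoly_eval c (o k) = crit_orbit d c k.
  by rewrite crit_orbit_rmorph /= intpoly_evalX.
have on_p : o n \in p by apply: ker_p; rewrite evo.
have [|m m_gt0 pE] := @periodic_dvdn (fun k => o k \in p) n _ n_gt0 on_p.
  move=> j [|k] oj; first by rewrite add0n oj /o /crit_orbit /= idealr0.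
  have [s os] := crit_orbitD d ('X : {poly int}) j (ltn0Sn k).
  rewrite (os : o (k.+1 + j)%N = o k.+1 + o j ^+ d * s).
  by rewrite rpredDr // mulrC idealMr // -(prednK d_gt0) exprSr idealMr.
have m_n : (m %| n)%N by rewrite -pE.
rewrite -/(o i) pE gtnNdvd //; have [//|n_m] := ltnP i m.
have om_p : o m \in p by rewrite pE.
have m_lt : (0 < m < n)%N by rewrite m_gt0 (leq_ltn_trans n_m).
case/dvdnP: m_n => e n_def.
have e_gt0 : (0 < e)%N by move: n_gt0; rewrite n_def muln_gt0 => /andP[].
have [s os] := crit_orbitM d ('X : {poly int}) m_gt0 e_gt0.
have : 1 + o m ^+ d.-1 * s \in p.
  have oE : o m * (1 + o m ^+ d.-1 * s) = o n.
    by rewrite /o [in RHS]n_def os mulrDr mulr1 mulrA -exprS prednK.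
  apply: ker_p; apply: (mulfI (o_neq0 m m_lt)); rewrite mulr0 -evo -rmorphM oE.
  exact: etrans (evo n) on0.
rewrite rpredDr ?idealr1 // mulrC idealMr // -(prednK (_ : 0 < d.-1)%N).
  by rewrite exprSr idealMr.
by rewrite -subn1 subn_gt0.
Qed.

End AtPrime.

Lemma parameter_integral : integralOver (intr : int -> K) c.
Proof.
exists (crit_orbit d 'X n); first by have [] := crit_orbitX_monic d_gt1 n_gt0.
rewrite rootE -[_.[c]]/(intpoly_eval c (crit_orbit d 'X n)) crit_orbit_rmorph /=.
by rewrite intpoly_evalX on0.
Qed.

Section PrimeOfIntegers.
Variable P : prime_idealr (ringOfIntegers K).
Hypothesis d_P : d%:R \in P.

Let c_int : c \in @int_closure K.
Proof. by apply/asboolP; exact: parameter_integral. Qed.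

Let cO : ringOfIntegers K := RingOfIntegers c_int.

Let valO b : val (intpoly_eval cO b) = intpoly_eval c b.
Proof. exact: (rmorph_intpoly_eval (val : {rmorphism ringOfIntegers K -> K})). Qed.

Let onO : crit_orbit d cO n = 0.
Proof.
by apply: val_inj; rewrite (crit_orbit_rmorph (val : {rmorphism ringOfIntegers K -> K})).
Qed.

Section Contraction.
Variable p : prime_idealr {poly int}.
Hypothesis pE : forall b, (b \in p) = (intpoly_eval cO b \in P).

Local Notation V := (local_ring (intpoly_eval c) p).

Let ker_p b : intpoly_eval c b = 0 -> b \in p.
Proof.
move=> b0; rewrite pE (_ : intpoly_eval _ _ = 0) ?idealr0 //.
by apply: val_inj; rewrite valO b0.
Qed.

Let d_p : d%:R \in p. Proof. by rewrite pE rmorph_nat. Qed.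

Let V_int (x : ringOfIntegers K) : val x \in V.
Proof.
apply: (valuation_ring_integral (periodic_local_val ker_p d_p)).
by have /asboolP := valP x.
Qed.

Let V_P (x : ringOfIntegers K) : x \in P -> val x / d%:R \in V.
Proof.
move=> xP; have [//|/asboolP[s [b [sp sx]]]] := periodic_local_max ker_p (V_int x).
have [x0|x_neq0] := eqVneq (val x) 0; first by rewrite x0 mul0r rpred0.
case/negP: sp; rewrite pE.
suff -> : intpoly_eval cO s = intpoly_eval cO b * x by rewrite idealMr.
by apply: val_inj; rewrite rmorphM /= !valO -sx divfK.
Qed.

Let ideal_pow_V m (x : ringOfIntegers K) :
  in_ideal_pow P m x -> val x / d%:R ^+ m \in V.
Proof.
elim: m x => [|m IHm] x; first by rewrite expr0 divr1 V_int.
case=> s [sP ->]; rewrite rmorph_sum mulr_suml big_seq rpred_sum // => w /sP[w1 w2].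
by rewrite rmorphM exprS invfM mulrACA rpredM ?V_P ?IHm.
Qed.

(** For [s] outside [P] the power [s ^ (d ^ n - 1)] is [1] modulo [P].
    Multiplying [x] by it clears the denominator of [x / d ^ m], while changing
    [x] only by an element of the next power of [P]; so [x] climbs through the
    powers of [P] one at a time. *)
Let V_ideal_pow m (x : ringOfIntegers K) :
  val x / d%:R ^+ m \in V -> in_ideal_pow P m x.
Proof.
case/asboolP => s [b [sp sx]]; have d_neq0 : (d%:R : K) != 0 by rewrite natr_neq0.
set sO := intpoly_eval cO s; set bO := intpoly_eval cO b.
have sxO : sO * x = d%:R ^+ m * bO.
  apply: val_inj; rewrite !rmorphM rmorphXn rmorph_nat /= !valO -sx.
  by rewrite [RHS]mulrCA [_ * (_ / _)]mulrC divfK ?expf_neq0.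
have e1 : 1 - sO ^+ (d ^ n).-1 \in P.
  have [t st] := frobenius_mod d_pr onO s; rewrite -/sO in st.
  have : sO * (1 - sO ^+ (d ^ n).-1) \in P.
    rewrite mulrBr mulr1 -exprS prednK ?(ltnW dn_gt1) // st opprD addNKr.
    by rewrite rpredN mulrC idealMr.
  by rewrite prime_idealrM -pE (negPf sp).
suff : forall l, (l <= m)%N -> in_ideal_pow P l x by apply.
elim=> // l IHl l_m; rewrite -[x](subrK (sO ^+ (d ^ n).-1 * x)).
apply: in_ideal_powD.
  by rewrite -{1}[x]mul1r -mulrBl; apply: in_ideal_powS => //; apply: IHl; apply: ltnW.
have -> : sO ^+ (d ^ n).-1 * x =
    d%:R ^+ l.+1 * (d%:R ^+ (m - l.+1) * bO * sO ^+ (d ^ n).-2).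
  rewrite [RHS]mulrA [_ * (_ * bO)]mulrA -exprD subnKC // -sxO.
  rewrite [(_).-1 in LHS](_ : _ = (d ^ n).-2.+1) ?exprS; first by ring.
  by case: (d ^ n)%N dn_gt1 => [|[]].
exact: in_ideal_powX.
Qed.

Let has_ordE (x : ringOfIntegers K) m : has_ord P x m ->
  val x / d%:R ^+ m \in V /\ val x / d%:R ^+ m / d%:R \notin V.
Proof.
case=> xm xm1; split; first exact: ideal_pow_V.
by rewrite -mulrA -invfM -exprSr; apply/negP => /V_ideal_pow.
Qed.

(** On the integers of [K] the order at [P] is the exponent of [d], so an
    element of valuation one is [d] times a unit. *)
Lemma valuation1_local (alpha : K) : has_valuation P alpha 1 ->
  alpha / d%:R \in V /\ alpha / (d%:R * d%:R) \notin V.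
Proof.
case=> x [y [m [l [y_neq0 -> /has_ordE[xV xNV] /has_ordE[yV yNV] ml]]]].
have {ml} ml : m = l.+1 by apply/eqP; rewrite -eqz_nat -[m%:Z](subrK l%:Z) -ml.
have d_neq0 : (d%:R : K) != 0 by rewrite natr_neq0.
have dl_neq0 := expf_neq0 l d_neq0.
set u := val y / d%:R ^+ l in yV yNV.
have u_neq0 : u != 0 by apply: contraNneq yNV => ->; rewrite mul0r rpred0.
have uV : u^-1 \in V.
  by case: (periodic_local_max ker_p yV) => // udV; case/negP: yNV.
have xyE : val x / val y / d%:R = val x / d%:R ^+ m / u.
  have vy_neq0 : val y != 0 by apply: contraNneq u_neq0 => y0; rewrite /u y0 mul0r.
  by rewrite ml /u exprS; field; rewrite d_neq0 dl_neq0 vy_neq0.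
rewrite xyE; split; first by rewrite rpredM.
apply: contra xNV; rewrite invfM mulrA xyE => /(fun h => rpredM h yV).
by rewrite mulrAC divfK.
Qed.

End Contraction.

(** [f^(n * m) - alpha] is monic, has constant term [- alpha], and its other
    coefficients are multiples of [d]. *)
Lemma valuation1_stable (alpha : K) : has_valuation P alpha 1 ->
  stable (unicrit d c) alpha.
Proof.
move=> alphaP m m_gt0; have [p pE'] := prime_idealr_preim (intpoly_eval cO) P.
have pE b : (b \in p) = (intpoly_eval cO b \in P) by rewrite pE'.
have ker_p b : intpoly_eval c b = 0 -> b \in p.
  move=> b0; rewrite pE (_ : intpoly_eval _ _ = 0) ?idealr0 //.
  by apply: val_inj; rewrite valO b0.
have d_p : d%:R \in p by rewrite pE rmorph_nat.
have [alphaV alphaNV] := valuation1_local pE alphaP.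
have m_nm : (m <= n * m)%N by rewrite leq_pmull.
apply: (@irreducible_comp _ _ (iterp (unicrit d c) (n * m - m))).
  by rewrite size_iterp // ltnS expn_gt0 d_gt0.
rewrite comp_polyB comp_polyC -iterpD subnKC //.
have [f_mon size_f] := iterp_sub_monic c d_gt1 (n * m) alpha.
have onm0 : crit_orbit d c (n * m) = 0.
  by case: m m_gt0 {m_nm f_mon size_f} => // m _; rewrite mulnS crit_orbit_period.
have f0 : (iterp (unicrit d c) (n * m) - alpha%:P)`_0 = - alpha.
  by rewrite coefB coefC coef0_iterp // onm0 sub0r.
apply: (local_eisenstein ker_p d_p) => //; first by rewrite size_f ltnS expn_gt0 d_gt0.
- rewrite size_f => -[_|i i_lt]; first by rewrite f0 mulNr rpredN.
  have [E fE] := @coef_iterp_mod d d_pr _ c (n * m)%N i.+1 i_lt.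
  rewrite coefB coefC subr0 fE mulrC mulKf ?natr_neq0 //.
  exact: local_ring_ev.
- by rewrite f0 mulNr rpredN.
Qed.

End PrimeOfIntegers.

(** [d] is not invertible in [Z[c]], whose elements are integral. *)
Lemma prime_over_exists : exists p : prime_idealr {poly int},
  (forall b, intpoly_eval c b = 0 -> b \in p) /\ d%:R \in p.
Proof.
pose I (b : {poly int}) := exists e, intpoly_eval c b = d%:R * intpoly_eval c e.
have [|||p pI] := @prime_idealr_exists {poly int} I.
- by exists 0; rewrite !rmorph0 mulr0.
- move=> a x y [e xe] [e' ye']; exists (a * e + e').
  by rewrite !rmorphD !rmorphM /= xe ye'; ring.
- case=> e /esym; rewrite rmorph1; apply: prime_not_inverted => //.
  apply: integral_horner parameter_integral; apply/integral_poly => i.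
  by rewrite coef_map; apply: integral_id.
exists p; split=> [b b0|]; apply: pI; first by exists 0; rewrite b0 rmorph0 mulr0.
by exists 1; rewrite rmorph_nat rmorph1 mulr1.
Qed.

Hypothesis o_neq0 : forall i, (0 < i < n)%N -> crit_orbit d c i != 0.

(** Enlarging [k] to [i + n * k] makes [f^k] congruent to ['X^(d ^ k) + a_i]
    modulo [d], so that the quotient becomes a power of ['X] modulo [d], with
    constant term [d * a_i ^ (d - 1)]. *)
Lemma diff_quot_irreducible k i : (0 < i < n)%N ->
  irreducible_poly (diff_quot d c k (crit_orbit d c i)).
Proof.
move=> i_n; have /andP[i_gt0 _] := i_n.
have [p [ker_p d_p]] := prime_over_exists.
have evo l : intpoly_eval c (crit_orbit d 'X l) = crit_orbit d c l.
  by rewrite crit_orbit_rmorph /= intpoly_evalX.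
set k' := (i + n * k)%N.
have k_k' : (k <= k')%N by rewrite (leq_trans (leq_pmull k n_gt0)) // leq_addl.
apply: (@irreducible_comp _ _ (iterp (unicrit d c) (k' - k))).
  by rewrite size_iterp // ltnS expn_gt0 d_gt0.
rewrite -diff_quot_comp subnKC //.
rewrite -(crit_orbit_period d_gt1 on0 k i_gt0) -/k'.
have [D_mon size_D] := diff_quot_monic c d_gt1 k' (crit_orbit d c k').
have d1_gt0 : (0 < d.-1)%N by rewrite -subn1 subn_gt0.
apply: (local_eisenstein ker_p d_p) => //.
- by rewrite size_D ltnS muln_gt0 expn_gt0 d_gt0.
- rewrite size_D => l l_lt; have [E ->] := coef_diff_quot_mod d_pr c l_lt.
  by rewrite mulrC mulKf ?natr_neq0 // local_ring_ev.
rewrite coef0_diff_quot // invfM mulrACA divff ?natr_neq0 // mul1r.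
rewrite /k' (crit_orbit_period d_gt1 on0) // -evo -rmorphXn.
apply: at_prime_unit => //; have := crit_orbit_notin_prime ker_p o_neq0 i_n.
by rewrite -(prednK d1_gt0); elim: d.-2 => // l IHl op; rewrite exprS prime_idealrM negb_or op IHl.
Qed.

End PeriodicParameter.

(** * The factors are distinct *)

(** The indices of the first family exceed [r] by [(q - j - 1) * n + (n - i)],
    from which [j] and [i] are recovered by division by [n]; those of the second
    family are less than [r].  An index determines the degree of its factor. *)
Lemma uniq_descent_indices n q r : (r < n)%N ->
  uniq ([seq (n * q + r - n * j - i)%N | j <- iota 0 q, i <- iota 1 n.-1] ++
        [seq (r - i)%N | i <- iota 1 r]).
Proof.
move=> r_n.
have kji j i : (j < q)%N -> (0 < i < n)%N ->
    (n * q + r - n * j - i = r + ((q - j.+1) * n + (n - i)))%N.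
  move=> j_q /andP[_ i_n]; have : (n * q = n * j + ((q - j.+1) * n + n))%N.
    by rewrite [((q - _) * n)%N]mulnC -mulnSr -mulnDr subnSK // subnKC // ltnW.
  by move: (n * q)%N (n * j)%N ((q - j.+1) * n)%N => a b e; lia.
have mem_n i : (1 <= i < 1 + n.-1)%N -> (0 < i < n)%N by lia.
rewrite cat_uniq; apply/and3P; split.
- apply: allpairs_uniq; rewrite ?iota_uniq // => -[j i] [j' i'] /=.
  move=> /allpairsP[[? ?] [/= + + [-> ->]]] /allpairsP[[? ?] [/= + + [-> ->]]].
  rewrite !mem_iota /= => j_q /mem_n i_n j'_q /mem_n i'_n.
  rewrite !kji // => /eqP; rewrite eqn_add2l => /eqP e.
  have := congr1 (divn^~ n) e; rewrite !divnMDl ?divn_small; [|lia..].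
  by rewrite !addn0 => jj'; move: e; rewrite jj' => e; congr (_, _); lia.
- apply/hasPn => k k_r; have [i + ->] := mapP k_r; rewrite mem_iota => i_r.
  apply/negP => /allpairsP[[j i'] [/=]]; rewrite !mem_iota => j_q /mem_n i'_n.
  by rewrite kji //; move: ((q - j.+1) * n)%N => a; lia.
- by rewrite map_inj_in_uniq ?iota_uniq // => x y; rewrite !mem_iota; lia.
Qed.

(** * Stability and factorization *)

(* K is the number field Q(c0): a finite extension of Q with a distinguished
   embedding phi into the complex numbers, generated by the element c with
   phi c = c0. *)
Theorem theorem1p5 (R : realType) (d : nat) (d_prime : prime d)
    (n : nat) (n_gt0 : (0 < n)%N)
    (G : {poly int}) (GP : is_gleason d n G)
    (c0 : R[i]) (c0_root : root (map_poly (intr : int -> R[i]) G) c0)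
    (K : fieldExtType rat) (phi : {rmorphism K -> R[i]})
    (c : K) (phi_c : phi c = c0) (K_gen : <<1; c>>%VS = fullv) :
  (* (a) *)
  (forall alpha : K,
     (exists P : prime_idealr (ringOfIntegers K),
        d%:R \in P /\ has_valuation P alpha 1) ->
     stable (unicrit d c) alpha)
  /\
  (* (b); FK k i is F_{k,i}, as a polynomial with coefficients in K *)
  ((1 < n)%N ->
   forall zeta : R[i], zeta ^+ d = 1 -> zeta != 1 ->
   exists FK : nat -> nat -> {poly K},
     (forall k i : nat, (0 < i < n)%N ->
        map_poly phi (FK k i) = F_fac d zeta c0 k i)
     /\
     forall k q r : nat, (0 < k)%N -> k = (n * q + r)%N -> (r < n)%N ->
       let factors :=
         [seq FK (k - n * j - i)%N (n - i)%N
            | j <- iota 0 q, i <- iota 1 n.-1] ++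
         [seq FK (r - i)%N (n - i)%N | i <- iota 1 r] in
       [/\ iterp (unicrit d c) k =
             (\prod_(0 <= j < q) \prod_(1 <= i < n)
                FK (k - n * j - i)%N (n - i)%N ^+ (d ^ j)%N) *
             (('X - (a_val d c (n - r))%:P) *
                \prod_(1 <= i < r.+1) FK (r - i)%N (n - i)%N) ^+ (d ^ q)%N,
           uniq factors
         & forall p, p \in factors -> irreducible_poly p]).
Proof.
have d_gt1 := prime_gt1 d_prime; have d_gt0 := prime_gt0 d_prime.
have rootK : root (map_poly (intr : int -> K) G) c.
  move: c0_root; rewrite -phi_c; suff -> : map_poly (intr : int -> R[i]) G =
      map_poly phi (map_poly (intr : int -> K) G) by rewrite fmorph_root.
  by rewrite -map_poly_comp; apply: eq_map_poly => z /=; rewrite rmorph_int.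
have [on0 o_neq0] := gleason_root_period d_gt1 n_gt0 GP rootK.
split=> [alpha [P [d_P alphaP]]|n_gt1 zeta zeta_d zeta_neq1].
  exact: (valuation1_stable K_gen d_prime n_gt0 on0 d_P alphaP).
pose FK k i := diff_quot d c k (crit_orbit d c i).
exists FK; split=> [k i i_n|k q r k_gt0 k_def r_n factors].
  have /andP[i_gt0 _] := i_n.
  rewrite map_diff_quot /= crit_orbit_rmorph phi_c /F_fac a_valE //.
  apply: diff_quot_fac => //.
  by rewrite -phi_c -crit_orbit_rmorph fmorph_eq0 o_neq0.
have FK_size k' i : size (FK k' i) = (d ^ k' * d.-1).+1.
  by have [] := diff_quot_monic c d_gt1 k' (crit_orbit d c i).
split.
- by rewrite k_def a_valE ?subn_gt0 // (iterp_factor d_gt1 q n_gt0 on0 r_n).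
- apply: (@map_uniq _ _ (fun p : {poly K} => size p)).
  rewrite map_cat map_allpairs -map_comp.
  have := uniq_descent_indices q r_n.
  rewrite -(map_inj_uniq (f := fun k' => (d ^ k' * d.-1).+1)) => [|x y]; last first.
    have d1_gt0 : (0 < d.-1)%N by rewrite -subn1 subn_gt0.
    by case=> /eqP; rewrite eqn_pmul2r // eqn_exp2l // => /eqP.
  rewrite map_cat map_allpairs -map_comp -k_def.
  congr (uniq (_ ++ _)).
    by apply: eq_allpairs => j i; rewrite FK_size.
  by apply: eq_map => i /=; rewrite FK_size.
- have irr k' i : (0 < i < n)%N -> irreducible_poly (FK k' (n - i)%N).
    by move=> i_n; apply: (diff_quot_irreducible K_gen d_prime n_gt0 on0 o_neq0); lia.
  move=> p; rewrite mem_cat => /orP[/allpairsP[[j i] [_ /=]]|p_r].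
    by rewrite mem_iota => i_n ->; apply: irr; lia.
  have [i + ->] := mapP p_r; rewrite mem_iota => i_r; apply: irr; lia.
Qed.
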